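(* Let $G$ be a finite non-nilpotent soluble group, write $\sigma=\sigma(G)$, and suppose $\mathfrak{m}(G)=2\sigma-1$. Then $\sigma\neq 3$ and one of the following holds: (i) $G/\Phi(G)\cong(E_{\sigma-1}\rtimes \mathbb{Z}_t)\times\mathbb{Z}_{p_1\cdots p_{\ell}}$, where $t$ is a positive integer dividing $|\mathrm{Aut}(E_{\sigma-1})|$, $p_1,\dots,p_{\ell}$ are distinct primes coprime to $t$, and $\ell=\sigma-\mathfrak{m}(\mathbb{Z}_t)$; (ii) $G/\Phi(G)\cong(E_{\sigma-1}\times E_{\sigma-1})\rtimes\mathbb{Z}_{p^{\alpha}}$, where $p$ is a prime and $\alpha\in\mathbb{N}$ is such that $p^{\alpha}$ divides $|\mathrm{Aut}(E_{\sigma-1})|$.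
   Context: For a finite group $G$, $\mathfrak{m}(G)$ is the number of maximal subgroups of $G$, and, for $G$ non-cyclic, $\sigma(G)$ is the least positive integer $n$ such that $G$ is the union of $n$ proper subgroups. $\Phi(G)$ is the Frattini subgroup. $E_n$ denotes an elementary abelian group of order $n$ (so $n$ is a prime power), and $\mathbb{Z}_n$ the cyclic group of order $n$. *)

(* Defs.v *)
From mathcomp Require Import all_boot all_fingroup all_solvable.

Set Implicit Arguments.
Unset Strict Implicit.
Unset Printing Implicit Defensive.

Import GroupScope.

Section Defs.

Variable gT : finGroupType.
Implicit Types (G H : {group gT}) (C : {set {group gT}}).

Definition num_maximal G : nat := #|[set M : {group gT} | maximal M G]|.

Definition proper_cover G C : bool :=
  [forall H in C, H \proper G] && (\bigcup_(H in C) H == G :> {set gT}).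

(* The family of all proper subgroups is the seed of the minimisation; it is  *)
(* a cover iff G is not cyclic, and the value is meaningless for G cyclic.    *)
Definition covering_number G : nat :=
  #|[arg min_(C < [set H : {group gT} | H \proper G] | proper_cover G C) #|C|]|.

Lemma proper_cover_all G :
  ~~ cyclic G -> proper_cover G [set H : {group gT} | H \proper G].
Proof.
move=> ncG; apply/andP; split; first by apply/forall_inP=> H; rewrite inE.
rewrite eqEsubset; apply/andP; split.
  by apply/bigcupsP=> H; rewrite inE => /proper_sub.
apply/subsetP=> x xG; apply/bigcupP; exists <[x]>%G; last exact: cycle_id.
rewrite inE properEneq cycle_subG xG andbT.
by apply: contraNneq ncG => <-; apply: cycle_cyclic.
Qed.

(* Repetitions among the n subgroups do not matter: the covering number is    *)
(* also the least length of an indexed cover by proper subgroups.             *)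
Lemma covering_numberP G : ~~ cyclic G ->
  (exists F : 'I_(covering_number G) -> {group gT},
     (forall i, F i \proper G) /\ \bigcup_i F i = G) /\
  (forall n (F : 'I_n -> {group gT}), (forall i, F i \proper G) ->
     \bigcup_i F i = G -> covering_number G <= n).
Proof.
move=> ncG; rewrite /covering_number.
case: arg_minnP => [|C /andP[/forall_inP prC /eqP defG] minC].
  exact: proper_cover_all.
split.
  exists enum_val; split=> [i|]; first exact/prC/enum_valP.
  by rewrite -[RHS]defG [RHS]big_enum_val.
move=> n F prF defF; rewrite -[leqRHS]card_ord -cardsT.
apply: leq_trans (leq_imset_card F [set: 'I_n]); apply: minC.
apply/andP; split; first by apply/forall_inP=> _ /imsetP[i _ ->].
rewrite -defF eqEsubset; apply/andP; split; apply/bigcupsP.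
  by move=> _ /imsetP[i _ ->]; apply: (bigcup_sup i).
by move=> i _; apply: (bigcup_sup (F i)); rewrite ?imset_f.
Qed.

End Defs.

(* Main.v *)
(** Write [s] for the covering number. A cover by maximal subgroups restricts to
    a chief factor, and counting cosets there shows that some maximal subgroups
    have index less than [s]. For the upper bounds on [s]: two normal maximal
    subgroups of index [p] give a quotient of order [p ^ 2], covered by [p + 1]
    subgroups; a nonnormal maximal subgroup [M] that is abelian modulo its core
    gives a Frobenius quotient, covered by its kernel [V] and the [#|V|]
    complements. The general bound [s <= #|G : M| + 1] is obtained only when
    [num_maximal G < 2 * s], by induction. If [M] is nonabelian modulo its core
    and [#|V| + 1 < s], then the linear group [G / V] acting on [V] inherits the
    hypothesis, has few enough maximal subgroups to possess a single class of
    nonnormal ones, hence a normal [r]-subgroup covering the corresponding chief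
    factor [W]; and an [r]-group acting faithfully and coprimely on [V] satisfies
    [#|W| <= #|V|], so [s <= #|W| + 1 <= #|V| + 1].

    If [num_maximal G = 2 * s - 1], every nonnormal class therefore has at least
    [s - 1] members, and there are one or two such classes, with [s] or [1] normal
    maximal subgroups respectively; modulo the Frattini subgroup these are the two
    cases of the theorem, the derived subgroup being [E], resp. [E1 \x E2]. *)

Require Import Defs.
From mathcomp Require Import all_boot all_fingroup all_solvable.
From mathcomp Require Import ssralg zmodp mxalgebra mxrepresentation mxabelem.
From mathcomp Require Import zify.

Set Implicit Arguments.
Unset Strict Implicit.
Unset Printing Implicit Defensive.

Import GroupScope.

(** * Coprime actions on abelian groups *)

Section CoprimeAction.

Variable gT : finGroupType.
Implicit Types A B Q S U V : {group gT}.

(** A faithful coprime [r]-group can be larger than the group it acts on: the semidihedral group of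
    order 16 acts faithfully on an elementary abelian group of order 9. So for a normal [r]-subgroup
    [Q] covering [W], only the order of [W], which is the index of a subgroup [L], is compared with
    [#|V|]. Choosing [Q] minimal puts its smaller invariant subgroups inside [L]. Two cases remain:
    a noncentral abelian invariant subgroup, whose centraliser can replace [L], or nilpotency class
    at most two, where [#|Q| < #|V|] does hold. The bound on indices assumes only
    [num_maximal G < 2 * s] because this inequality passes to noncyclic quotients: there the maximal
    subgroups get fewer and [s] cannot drop. An equality would not be inherited. *)

Lemma coprime_abel_dprod A V :
    A \subset 'N(V) -> coprime #|V| #|A| -> abelian V ->
  [~: V, A] \x 'C_V(A) = V.
Proof.
move=> nVA coVA abV.
have sRV: [~: V, A] \subset V by rewrite commg_subl.
have solV := abelian_sol abV.
have nRA: A \subset 'N([~: V, A]) by rewrite commg_normr.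
have nRV: V \subset 'N([~: V, A]) by rewrite commg_norml.
rewrite dprodE.
- apply/eqP; rewrite eqEsubset mul_subG ?subsetIl //=.
  rewrite -quotientSK // coprime_quotient_cent // subsetI subxx /=.
  by rewrite quotient_cents2r.
- exact: sub_abelian_cent2 abV (subsetIl _ _) sRV.
by rewrite setIA (setIidPl sRV) coprime_abel_cent_TI.
Qed.

Lemma coprime_commg_cent1 A U :
    A \subset 'N(U) -> coprime #|U| #|A| -> abelian U -> 'C_U(A) = 1 ->
  [~: U, A] = U.
Proof.
move=> nUA coUA abU regU; have:= coprime_abel_dprod nUA coUA abU.
by rewrite regU dprodg1.
Qed.

(* Independence of isotypic components, phrased without representations: the
   factor attached to a [B] of largest order splits off as a part of ['C_V(B)],
   and the remaining ones lie in [[~: V, B]]. *)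
Lemma prod_fixed_leq V (BB : {set {group gT}}) (U : {group gT} -> {group gT}) :
    abelian V ->
    {in BB, forall B : {group gT}, coprime #|V| #|B|} ->
    {in BB, forall B : {group gT}, B \subset 'N(V)} ->
    {in BB &, forall B C : {group gT}, B \subset 'N(C)} ->
    {in BB &, forall B C : {group gT}, B \subset 'N(U C)} ->
    {in BB, forall B : {group gT}, U B \subset 'C_V(B)} ->
    {in BB &, forall B C : {group gT}, ~~ (B \subset C) -> 'C_(U C)(B) = 1} ->
  \prod_(B in BB) #|U B| <= #|V|.
Proof.
move eqn: #|BB| => n; elim: n BB V eqn => [|n IHn] BB V cardBB.
  by move/eqP: cardBB; rewrite cards_eq0 => /eqP->; rewrite big_set0 => *.
move=> abV coV nV nB nU sU regU.
have [B0 B0in] : exists B, B \in BB by apply/card_gt0P; rewrite cardBB.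
have [B Bin maxB] := arg_maxnP (fun B : {group gT} => #|B|) B0in.
have{} Bin: B \in BB := Bin.
have {B0 B0in}nsub C : C \in BB :\ B -> ~~ (B \subset C).
  case/setD1P=> neCB Cin; apply: contra neCB => sBC.
  by rewrite -val_eqE eq_sym eqEcard sBC /=; apply: maxB.
have nVB := nV B Bin; have coVB := coV B Bin.
have defV := coprime_abel_dprod nVB coVB abV.
have sRV: [~: V, B] \subset V by rewrite commg_subl.
rewrite (big_setD1 B) //= -(dprod_card defV) mulnC leq_mul //; last first.
  by rewrite subset_leq_card ?sU.
have sBB : {subset BB :\ B <= BB} by move=> C /setD1P[].
apply: IHn => [|||||||] /=.
- by move: cardBB; rewrite (cardsD1 B) Bin => -[].
- exact: abelianS abV.
- by move=> C /sBB Cin; apply: coprime_dvdl (coV C Cin); apply: cardSg.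
- by move=> C /sBB Cin; rewrite normsR ?nV ?nB.
- by move=> C D /sBB Cin /sBB Din; apply: nB.
- by move=> C D /sBB Cin /sBB Din; apply: nU.
(* Since [B] fixes nothing in [U C], coprimeness gives [U C = [~: U C, B]], a subgroup of
   [[~: V, B]]. *)
- move=> C C'; have Cin := sBB C C'.
  have [sUV cUC]: U C \subset V /\ U C \subset 'C(C) by apply/subsetIP/sU.
  rewrite subsetI cUC andbT -{1}(coprime_commg_cent1 (nU B C Bin Cin)).
  + exact: commSg.
  + exact: coprime_dvdl (cardSg sUV) coVB.
  + exact: abelianS abV.
  exact: regU Bin Cin (nsub C C').
by move=> C D /sBB Cin /sBB Din; apply: regU.
Qed.

(** Schur's lemma: on the irreducible [U], the abelian group [A] acts through the multiplicative
    group of a finite field. *)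
Lemma abelian_minnormal_cyclic A U :
  abelian A -> minnormal U A -> abelian U -> cyclic (A / 'C_A(U)).
Proof.
move=> abA minU abU.
have [nUA ntU /is_abelemP[p p_pr abelU]] :=
  minnormal_solvable minU (subxx U) (abelian_sol abU).
pose rG := abelem_repr abelU ntU nUA.
have irrG: mx_irreducible rG by apply/abelem_mx_irrP.
rewrite -(rker_abelem abelU ntU nUA).
apply: (mx_faithful_irr_abelian_cyclic (kquo_mx_faithful rG)).
  exact/quo_mx_irr.
exact: quotient_abelian.
Qed.

Lemma abelian_semiregular_cyclic A V :
    abelian A -> A \subset 'N(V) -> abelian V -> V :!=: 1 ->
    {in A^#, forall a, 'C_V[a] = 1} ->
  cyclic A.
Proof.
move=> abA nVA abV ntV regA.
have [U minU sUV] := minnormal_exists ntV nVA.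
have [/andP[ntU nUA] _] := mingroupP minU.
have := abelian_minnormal_cyclic abA minU (abelianS sUV abV).
suffices ->: 'C_A(U) = 1 by rewrite (isog_cyclic (quotient1_isog A)).
apply/trivgP/subsetP=> a /setIP[Aa cUa]; apply: contraR ntU => nta.
rewrite -subG1 -(regA a); last by rewrite !inE Aa -in_set1 nta.
by rewrite subsetI sUV sub_cent1.
Qed.

End CoprimeAction.

(* The commutator pairing of [S] with [Q / 'C_Q(S)] takes values in a cyclic
   group, so that only the multiplicity of each prime in the index matters. *)
Lemma card_leq_index_cent gT (Q S : {group gT}) :
    S \subset Q -> S :&: 'Z(Q) = 1 -> Q^`(1) \subset 'Z(Q) -> cyclic 'Z(Q) ->
  #|S| <= #|Q : 'C_Q(S)|.
Proof.
move=> sSQ tiSZ sQ'Z cycZ.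
(* The inequality is proved for every [C] above the derived subgroup, with ['C_S(C)] for [S],
   climbing to [Q] by prime steps; [C = 'C_Q(S)] gives back [S]. *)
have main n (C : {group gT}) : #|Q : C| <= n -> Q^`(1) \subset C ->
    C \subset Q -> #|'C_S(C)| <= #|Q : C|.
  elim: n C => [|n IHn] C; first by rewrite leqNgt indexg_gt0.
  move=> leQCn sQ'C sCQ; have nsCQ := sub_der1_normal sQ'C sCQ.
  have [sQC | nsQC] := boolP (Q \subset C).
    have/eqP->: C :==: Q by rewrite eqEsubset sCQ.
    rewrite indexgg; suff ->: 'C_S(Q) = 1 by rewrite cards1.
    by apply/trivgP; rewrite -tiSZ subsetI subsetIl setSI.
  have ntQC: Q / C != 1 by rewrite -subG1 quotient_sub1 ?normal_norm.
  pose l := pdiv #|Q / C|.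
  have l_pr: prime l by rewrite pdiv_prime ?cardG_gt1.
  have [_ /morphimP[h Nh Qh ->] oh] := Cauchy l_pr (pdiv_dvd #|Q / C|).
  have Ch_l: h ^+ l \in C.
    by apply: coset_idr; rewrite ?groupX // morphX // -oh expg_order.
  pose C1 := (C <*> <[h]>)%G.
  have sC1Q: C1 \subset Q by rewrite join_subG sCQ cycle_subG.
  have sCC1: C \subset C1 := joing_subl _ _.
  have oC1: #|C1 : C| = l.
    rewrite -card_quotient; last by rewrite (subset_trans sC1Q) ?normal_norm.
    by rewrite quotientYidl ?cycle_subG // quotient_cycle.
  have IH le_n := IHn C1 le_n (subset_trans sQ'C sCC1) sC1Q.
  rewrite -(Lagrange_index sC1Q sCC1) oC1 in leQCn *.
  have sZ s : s \in Q -> [~ s, h] \in 'Z(Q).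
    by move=> Qs; rewrite (subsetP sQ'Z) // mem_commg.
  have sSC s : s \in 'C_S(C) -> s \in Q by case/setIP=> /(subsetP sSQ).
  have phiM: {in 'C_S(C) &, {morph commg^~ h : s t / s * t}}.
    move=> s t /sSC Qs /sSC Qt /=; rewrite commMgJ.
    have /setIP[_ cQs] := sZ s Qs.
    by rewrite (conjg_fixP _) //; apply/commgP/(centP cQs).
  pose phi := Morphism phiM.
  have kerphi: 'ker phi \subset 'C_S(C1).
    apply/subsetP=> s /morphpreP[/setIP[Ss cCs] /set1P/= sh1].
    rewrite inE Ss /= centY inE cCs cent_cycle; apply/cent1P.
    exact/commgP/eqP.
  (* The image lies in a cyclic group, so it is generated by a single commutator [[~ s, h]], whose
     order divides [l] because [h ^+ l] is in [C]. *)
  have im_l: #|phi @* 'C_S(C)| <= l.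
    have sIZ: phi @* 'C_S(C) \subset 'Z(Q).
      by apply/subsetP=> _ /morphimP[s Cs _ ->]; apply/sZ/sSC.
    have /cyclicP[y defy] := cyclicS sIZ cycZ; rewrite defy -orderE.
    have: y \in phi @* 'C_S(C) by rewrite defy cycle_id.
    case/morphimP=> s Cs _ ->; apply: (dvdn_leq (prime_gt0 l_pr)).
    have /setIP[_ cQs] := sZ s (sSC s Cs).
    rewrite order_dvdn -commgX; last by red; rewrite (centP cQs).
    by apply/commgP; case/setIP: Cs => _ /centP; apply.
  have le_n: #|Q : C1| <= n.
    by rewrite -ltnS (leq_trans _ leQCn) // ltn_Pmulr ?indexg_gt0 ?prime_gt1.
  apply: leq_trans (leq_mul (IH le_n) (leqnn l)).
  rewrite card_morphim setIid in im_l.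
  rewrite -(LagrangeI 'C_S(C) ('ker phi)) leq_mul // subset_leq_card //.
  by rewrite subIset // kerphi orbT.
apply: leq_trans (main _ 'C_Q(S)%G (leqnn _) _ (subsetIl _ _)).
  rewrite subset_leq_card // subsetI subxx /= centsC subsetIr //.
rewrite subsetI der_sub (subset_trans sQ'Z) //.
exact: subset_trans (subsetIr _ _) (centS sSQ).
Qed.

(** * Coprime action of groups of class at most two *)

(** Final comparison in the bound for class two. At [c = 2], [k = 2] both sides are equal, so
    [2 < c] has to be secured there. *)
Lemma sqr_mul_pred_lt_exp c k : 2 < c -> 1 < k -> k ^ 2 * c.-1 < c ^ k.
Proof.
move=> c_gt2; case: k => [|[|k]] // _; elim: k => [|k IHk].
  by case: c c_gt2 => [|[|[|c]]] // _; rewrite -subn_gt0 /= !expnS !expn0; lia.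
rewrite [X in _ < X]expnS; apply: leq_ltn_trans (_ : 3 * (k.+2 ^ 2 * c.-1) < _).
  by rewrite mulnA leq_mul2r -!mulnn; apply/orP; right; nia.
rewrite (@leq_ltn_trans (c * (k.+2 ^ 2 * c.-1))) ?leq_mul2r ?c_gt2 ?orbT //.
by rewrite ltn_pmul2l // ltnW // ltnW.
Qed.

(* When the centre [Z] acts fixed-point-freely, the stabiliser [S] of a vector is
   abelian and meets [Z] trivially; its [k] conjugates lie in the abelian group
   [S * Z] and have independent fixed spaces of the same order [c], so that
   [c ^ k <= #|V|], while [#|Q| <= k * k * c.-1] by induction applied to the
   action of ['C_Q(S) / S] on ['C_V(S)]. *)
Lemma class2_faithful_card_lt gT (Q V : {group gT}) :
    (forall Q1 V1 : {group gT}, abelian V1 -> V1 :!=: 1 -> #|V1| < #|V| ->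
      Q1 \subset 'N(V1) -> coprime #|V1| #|Q1| -> Q1^`(1) \subset 'Z(Q1) ->
      #|Q1 : 'C_Q1(V1)| < #|V1|) ->
    abelian V -> V :!=: 1 -> Q \subset 'N(V) -> coprime #|V| #|Q| ->
    Q^`(1) \subset 'Z(Q) -> 'C_Q(V) = 1 ->
  #|Q| < #|V|.
Proof.
move=> IH abV ntV nVQ coVQ sQ'Z regQV.
have class2 (H : {group gT}) : H \subset Q -> H^`(1) \subset 'Z(H).
  move=> sHQ; rewrite subsetI der_sub (subset_trans (dergS 1 sHQ)) //.
  by rewrite (subset_trans sQ'Z) // subIset // orbC centS.
(* A central [z] with nontrivial fixed points splits [V] into two [Q]-invariant factors. Induction
   applies to [Q] on [V1] and to its kernel [Q1], which is faithful on [V2]. *)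
have [/exists_inP[z /setD1P[ntz Zz] ntCz] | ] :=
  boolP [exists z in 'Z(Q)^#, 'C_V[z] != 1].
  have [Qz cQz] := setIP Zz.
  have sZV: <[z]> \subset 'N(V) by rewrite cycle_subG (subsetP nVQ).
  have coVz: coprime #|V| #|<[z]>|.
    by rewrite (coprime_dvdr (cardSg _) coVQ) ?cycle_subG.
  have /= defV := coprime_abel_dprod sZV coVz abV.
  pose V1 := 'C_V(<[z]>)%G; pose V2 := [~: V, <[z]>]%G.
  have sQz: Q \subset 'C(<[z]>) by rewrite centsC cycle_subG.
  have oV: (#|V2| * #|V1|)%N = #|V| := dprod_card defV.
  have ntV1: V1 :!=: 1 by rewrite /= cent_cycle.
  have ntV2: V2 :!=: 1.
    apply: contraNneq ntz => /commG1P; rewrite centsC cycle_subG => cVz.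
    by rewrite -in_set1 -[[set 1]]regQV inE Qz.
  have [lt1 lt2] : 1 < #|V1| /\ 1 < #|V2| by rewrite !cardG_gt1.
  have ltV1: #|V1| < #|V| by rewrite -oV ltn_Pmull // ltnW.
  have ltV2: #|V2| < #|V| by rewrite -oV ltn_Pmulr // ltnW.
  have sV1V: V1 \subset V := subsetIl _ _.
  have sV2V: V2 \subset V by rewrite commg_subl.
  have nV1Q: Q \subset 'N(V1) by rewrite normsI // norms_cent // cents_norm.
  have nV2Q: Q \subset 'N(V2) by rewrite normsR // cents_norm.
  pose Q1 := 'C_Q(V1)%G; have sQ1Q: Q1 \subset Q := subsetIl _ _.
  rewrite -(Lagrange sQ1Q) -oV ltn_mul //.
    rewrite -(indexg1 Q1); suff <-: 'C_Q1(V2) = 1.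
      apply: IH => //; rewrite ?(abelianS sV2V) ?class2 ?(subset_trans sQ1Q) //.
      by rewrite (coprime_dvdl (cardSg sV2V)) // (coprime_dvdr (cardSg sQ1Q)).
    rewrite -setIA -centY -regQV -(dprodWY defV); congr (_ :&: 'C(_)).
    exact: joingC.
  apply: IH => //; rewrite ?(abelianS sV1V) ?class2 //.
  by rewrite (coprime_dvdl (cardSg sV1V)).
rewrite negb_exists_in => /forall_inP regZ.
have{regZ} regZ z : z \in 'Z(Q) -> z != 1 -> 'C_V[z] = 1.
  by move=> Zz ntz; apply/eqP; rewrite -[_ == _]negbK regZ // in_setD1 ntz.
have sZQ: 'Z(Q) \subset Q := center_sub Q.
have cycZ: cyclic 'Z(Q).
  apply: (abelian_semiregular_cyclic (center_abelian Q) _ abV ntV).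
    exact: subset_trans nVQ.
  by move=> z /setD1P[ntz Zz]; apply: regZ.
(* If all stabilisers are trivial, one regular orbit inside [V^#] already gives the bound. *)
have [/exists_inP[x /setD1P[ntx Vx] ntS] | ] :=
  boolP [exists x in V^#, 'C_Q[x] != 1]; last first.
  rewrite negb_exists_in => /forall_inP regQ.
  have [x Vx ntx] := trivgPn _ ntV.
  have regx: 'C_Q[x] = 1 by apply/eqP; rewrite -[_ == _]negbK regQ // in_setD1 ntx.
  rewrite -(indexg1 Q) -regx index_cent1 (cardsD1 1 V) group1 ltnS.
  rewrite subset_leq_card //; apply/subsetP=> _ /imsetP[y Qy ->].
  by rewrite !inE conjg_eq1 ntx memJ_norm // (subsetP nVQ).
pose S := 'C_Q[x]%G; have sSQ: S \subset Q := subsetIl _ _.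
have cSx : S \subset 'C[x] := subsetIr _ _.
have tiSZ: S :&: 'Z(Q) = 1.
  apply/trivgP/subsetP=> z /setIP[/setIP[_ cxz] Zz]; rewrite inE.
  apply: contraR ntx => ntz; rewrite -in_set1 -[[set 1]](regZ z) //.
  by rewrite inE Vx cent1C.
have abS: abelian S.
  apply/derG1P/trivgP; rewrite -tiSZ subsetI der_sub.
  exact: subset_trans (dergS 1 sSQ) sQ'Z.
pose CS := 'C_Q(S)%G; have sCSQ: CS \subset Q := subsetIl _ _.
have sSCS: S \subset CS by rewrite subsetI sSQ.
(* The commutators of [S] with its normaliser lie in [S] and in the centre, hence vanish; so [S] has
   exactly [#|Q : CS|] conjugates. *)
have defN: 'N_Q(S) = CS.
  apply/eqP; rewrite eqEsubset; apply/andP; split; last exact/setIS/cent_sub.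
  rewrite subsetI subsetIl (sameP commG1P trivgP) -tiSZ subsetI commg_subr subsetIr.
  exact: subset_trans (commgSS (subsetIl _ _) sSQ) sQ'Z.
have leSk: #|S| <= #|Q : CS| := card_leq_index_cent sSQ tiSZ sQ'Z cycZ.
pose VS := 'C_V(S)%G; have sVSV: VS \subset V := subsetIl _ _.
have VSx: x \in VS by rewrite inE Vx -sub_cent1.
have ntVS: VS :!=: 1 by apply/trivgPn; exists x.
have nVS_CS: CS \subset 'N(VS).
  apply: normsI (subset_trans sCSQ nVQ) (norms_cent (cents_norm _)).
  exact: subsetIr.
have C_CS: 'C_CS(VS) = S.
  apply/eqP; rewrite eqEsubset subsetI sSCS centsC subsetIr !andbT.
  apply: setISS (subsetIl _ _) _; rewrite sub_cent1.
  by apply: (subsetP _ x VSx); rewrite centsC.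
have properVS: #|VS| < #|V|.
  rewrite proper_card // properE sVSV subsetI subxx /= centsC.
  apply: contra ntS => cSV; rewrite -subG1 -[1]regQV subsetI sSQ.
  exact: cSV.
have lt_c: #|CS : S| < #|VS|.
  rewrite -{1}C_CS; apply: IH; rewrite ?(abelianS sVSV) ?class2 //.
  by rewrite (coprime_dvdl (cardSg sVSV)) // (coprime_dvdr (cardSg sCSQ)).
have S_gt1: 1 < #|S| by rewrite cardG_gt1.
(* For a nontrivial central [z], the elements [1], [x] and [x ^ z] of [VS] are distinct. *)
have c_gt2: 2 < #|VS|.
  have ntZ: 'Z(Q) != 1.
    apply: contraNneq ntS => Z1; rewrite -subG1 -[1]Z1 /center subsetI sSQ.
    have /centsP cQQ: abelian Q by apply/derG1P/trivgP; rewrite -Z1.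
    by apply/centsP=> u /(subsetP sSQ) Qu v Qv; apply: cQQ.
  have [z Zz ntz] := trivgPn _ ntZ.
  have VSxz: x ^ z \in VS.
    by rewrite memJ_norm // (subsetP nVS_CS) // (subsetP _ z Zz) // setIS // centS.
  apply: leq_trans (subset_leq_card (_ : [set 1; x; x ^ z] \subset VS)); last first.
    by rewrite !subUset !sub1set VSx VSxz group1.
  rewrite -setUA cardsU1 cards2 !inE negb_or eq_sym ntx eq_sym conjg_eq1 ntx /=.
  rewrite (_ : x != x ^ z) //; apply: contra ntx => /eqP xz.
  rewrite -in_set1 -[[set 1]](regZ z) // inE Vx; apply/cent1P/commgP.
  by apply/conjg_fixP.
pose k := #|Q : CS|; pose BB := [set (S :^ y)%G | y in Q].
have oBB: #|BB| = k.
  by rewrite /k -defN -astab1JG -card_orbit; congr #|pred_of_set _|.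
have le_ckV: #|VS| ^ k <= #|V|.
  have: \prod_(B in BB) #|'C_V(B)%G| <= #|V|; last first.
    rewrite (eq_bigr (fun=> #|VS|)) ?prod_nat_const ?oBB //.
    move=> _ /imsetP[y Qy ->] /=; rewrite -(cardJg VS y) [VS :^ y]conjIg centJ.
    by rewrite (normsP nVQ).
  have sBSZ B : B \in BB -> B \subset S <*> 'Z(Q).
    case/imsetP=> y Qy ->; apply/subsetP=> _ /imsetP[s Ss ->].
    rewrite conjg_mulR groupM ?(subsetP (joing_subl _ _) s) //.
    rewrite (subsetP (joing_subr _ _)) // (subsetP sQ'Z) // mem_commg //.
    exact: subsetP Ss.
  have abSZ: abelian (S <*> 'Z(Q)).
    rewrite abelianY abS center_abelian /= (subset_trans (subsetIr _ _)) //.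
    by rewrite centS.
  have sSZQ: S <*> 'Z(Q) \subset Q by rewrite join_subG sSQ.
  have sBQ B : B \in BB -> B \subset Q by move/sBSZ/subset_trans->.
  have nBB B C : B \in BB -> C \in BB -> B \subset 'N(C).
    by move=> /sBSZ sB /sBSZ sC; rewrite cents_norm ?(sub_abelian_cent2 abSZ).
  apply: (prod_fixed_leq abV _ _ nBB) => [B|B|B C|//|B C] /=.
  - by move/sBQ=> sB; rewrite (coprime_dvdr (cardSg sB)).
  - by move/sBQ=> sB; rewrite (subset_trans sB).
  - move=> Bin Cin; apply: normsI (norms_cent (nBB B C Bin Cin)).
    exact: subset_trans (sBQ B Bin) nVQ.
  (* Conjugates of [s] differ by central elements: [z = (s ^ t)^-1 * s ^ y] is central, and
     nontrivial as [s ^ y] is outside [S :^ t]. It centralises whatever both conjugates of [S]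
     centralise, hence nothing nontrivial in [V]. *)
  case/imsetP=> y Qy -> /imsetP[t Qt ->] /subsetPn[_ /imsetP[s Ss ->] nSt].
  have Qs := subsetP sSQ s Ss.
  pose z := [~ s, t]^-1 * [~ s, y].
  have Zz: z \in 'Z(Q) by rewrite groupM ?groupV; rewrite // (subsetP sQ'Z) ?mem_commg.
  have defz: z = (s ^ t)^-1 * s ^ y by rewrite /z !commgEl invMg invgK -mulgA mulKVg.
  have ntz: z != 1.
    apply: contraNneq nSt; rewrite defz => /(canRL (mulKVg _)).
    by rewrite mulg1 => ->; rewrite memJ_conjg.
  apply/trivgP; rewrite -(regZ z Zz ntz) /= -setIA setIS //.
  rewrite -centY -cent_set1 centS // sub1set defz groupM ?groupV //.
    by rewrite (subsetP (joing_subl _ _)) // memJ_conjg.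
  by rewrite (subsetP (joing_subr _ _)) // memJ_conjg.
apply: leq_trans le_ckV.
have k_gt1: 1 < k := leq_trans S_gt1 leSk.
apply: leq_trans (sqr_mul_pred_lt_exp c_gt2 k_gt1); rewrite ltnS.
rewrite -(Lagrange sCSQ) -(Lagrange sSCS) -/k mulnC -mulnn -mulnA leq_mul2l.
by rewrite leq_mul ?orbT // -ltnS prednK // ltnW // ltnW.
Qed.

Section FaithfulQuotient.

Variables (gT : finGroupType) (Q V : {group gT}).
Hypotheses (nVQ : Q \subset 'N(V)) (coVQ : coprime #|V| #|Q|).
Let C := 'C_Q(V)%G.

(** By coprimeness [V] meets [C] trivially and survives in the quotient. An [x] centralising [V]
    modulo [C] has its commutators with [V] in [V :&: C], so it centralises [V]. *)
Lemma quotient_cent_faithful :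
  [/\ Q / C \subset 'N(V / C), #|V / C| = #|V|,
      coprime #|V / C| #|Q / C|, #|Q / C| = #|Q : C|
    & 'C_(Q / C)(V / C) = 1].
Proof.
have nCQ : Q \subset 'N(C) by rewrite normsI ?normG ?norms_cent.
have nCV : V \subset 'N(C) by rewrite cents_norm // centsC subsetIr.
have tiVC : C :&: V = 1.
  by rewrite setIC; apply: coprime_TIg; apply: coprime_dvdr coVQ; rewrite cardSg ?subsetIl.
split; first exact: quotient_norms.
- by rewrite -(card_isog (quotient_isog nCV tiVC)).
- exact: coprime_morph.
- exact: card_quotient.
apply/trivgP/subsetP=> _ /setIP[/morphimP[x Nx Qx ->] cVx].
rewrite inE; apply/eqP/coset_id; rewrite inE Qx /=.
have : <[x]> / C \subset 'C(V / C) by rewrite quotient_cycle // cycle_subG.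
rewrite quotient_cents2 ?cycle_subG // => sRC.
rewrite -cycle_subG; apply/commG1P/trivgP; rewrite -tiVC subsetI sRC /=.
by rewrite commg_subr cycle_subG (subsetP nVQ).
Qed.

End FaithfulQuotient.

Lemma class2_index_cent_lt gT (Q V : {group gT}) :
    abelian V -> V :!=: 1 -> Q \subset 'N(V) -> coprime #|V| #|Q| ->
    Q^`(1) \subset 'Z(Q) ->
  #|Q : 'C_Q(V)| < #|V|.
Proof.
move: {2}#|V|.+1 (ltnSn #|V|) => n.
elim: n => // n IHn in gT Q V *; rewrite ltnS => leVn abV ntV nVQ coVQ sQ'Z.
have [nVQb oV coVQb oQ regQb] := quotient_cent_faithful nVQ coVQ.
rewrite -oQ -[X in _ < X]oV; apply: class2_faithful_card_lt => //.
- move=> Q1 V1 abV1 ntV1 ltV1; apply: IHn => //.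
  by rewrite oV in ltV1; apply: leq_trans ltV1 leVn.
- exact: quotient_abelian.
- by rewrite -cardG_gt1 oV cardG_gt1.
set C := 'C_Q(V).
have nCQ : Q \subset 'N(C) by rewrite normsI ?normG ?norms_cent.
rewrite -quotient_der // (subset_trans (quotientS C sQ'Z)) //.
by rewrite subsetI quotientS ?center_sub // quotient_cents // subsetIr.
Qed.

(** * Groups of prime power order with a normal abelian subgroup *)

(** Legendre's formula bounds the exponent by [n / (p - 1)], and [p <= 2 ^ p.-1]. *)
Lemma pfactor_fact_leq p n : prime p -> p ^ logn p n`! <= 2 ^ n.
Proof.
move=> p_pr; rewrite logn_fact //; have p_gt1 := prime_gt1 p_pr.
set e := \sum_(1 <= k < n.+1) _.
have le_en: p.-1 * e <= n.
  suff main m: p.-1 * (\sum_(1 <= k < m.+1) n %/ p ^ k) + n %/ p ^ m <= n.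
    exact: leq_trans (leq_addr _ _) (main n).
  elim: m => [|m IHm].
    by rewrite big_geq // muln0 expn0 divn1.
  rewrite big_nat_recr //= mulnDr -addnA; apply: leq_trans IHm.
  rewrite leq_add2l expnSr divnMA; set a := n %/ _.
  by rewrite (leq_trans _ (leq_divM a p)) // addnC -mulSn prednK ?prime_gt0 // mulnC.
apply: leq_trans (leq_pexp2l _ le_en) => //; rewrite expnM.
case: e {le_en} => [|e]; first by rewrite !expn0.
by rewrite leq_exp2r //; case: p p_gt1 {p_pr} => // p _; apply: ltn_expl.
Qed.

Lemma pgroup_index_astab_leq (aT : finGroupType) (T : finType)
    (to : {action aT &-> T}) (p : nat) (Q : {group aT}) (S : {set T}) :
  p.-group Q -> [acts Q, on S | to] -> #|Q : 'C_Q(S | to)| <= 2 ^ #|S|.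
Proof.
move=> pQ nSQ; have [-> | ntQ] := eqsVneq Q 1; last have [p_pr _ _] := pgroup_pdiv pQ ntQ.
  by rewrite (eqP (_ : #|_ : _| == 1%N)) ?expn_gt0 // indexg_eq1 sub1G.
pose f := actperm <[nSQ]>.
have sSym: f @* Q \subset perm.Sym S.
  apply/subsetP=> _ /morphimP[a _ Qa ->]; rewrite inE; apply/subsetP=> x.
  by rewrite inE actpermE /= /actby; case: (x \in S); rewrite //= eqxx.
have <-: #|f @* Q| = #|Q : 'C_Q(S | to)|.
  by rewrite card_morphim ker_actperm astab_actby setIT setIid.
have pfQ: p.-group (f @* Q) := morphim_pgroup _ pQ.
rewrite (card_pgroup pfQ); apply: leq_trans (pfactor_fact_leq #|S| p_pr).
rewrite leq_exp2l ?prime_gt1 // dvdn_leq_log ?fact_gt0 //.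
by rewrite -perm.card_Sym cardSg.
Qed.

(** For [Y] of order [p ^ m.+1] the [p]-part of [#|Aut Y|] is [p ^ m], at most half of [#|Y|]; the
    successor serves [Y = 1]. The factor 2, gained once for each kernel in [BB], pays for the
    permutation factor [2 ^ #|BB|] in [pgroup_index_cent_abelian_leq]. *)
Lemma pgroup_index_cent_cyclic gT (p : nat) (X Y : {group gT}) :
    p.-group X -> p.-group Y -> cyclic Y -> X \subset 'N(Y) ->
  #|X : 'C_X(Y)|.*2 <= #|Y|.+1.
Proof.
move=> pX pY cycY nYX; have [-> | ntY] := eqsVneq Y 1;
  last have [p_pr _ [m oY]] := pgroup_pdiv pY ntY.
  rewrite (eqP (_ : #|_ : _| == 1%N)) ?cards1 // indexg_eq1 subsetI subxx.
  exact: cents1.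
pose f := conj_aut Y.
have <-: #|f @* X| = #|X : 'C_X(Y)|.
  by rewrite card_morphim ker_conj_aut (setIidPr nYX) indexgI.
have pfX: p.-group (f @* X) := morphim_pgroup _ pX.
have: #|f @* X| <= p ^ m.
  rewrite (card_pgroup pfX) leq_exp2l ?prime_gt1 //.
  have: #|f @* X| %| totient #|Y| by rewrite -card_Aut_cyclic // cardSg ?Aut_conj_aut.
  move=> dv; apply: leq_trans (dvdn_leq_log p _ dv) _; rewrite ?totient_gt0 //.
  have p1_gt0: 0 < p.-1 by rewrite -ltnS prednK ?prime_gt0 // prime_gt1.
  rewrite oY totient_pfactor // lognM //; last by rewrite expn_gt0 prime_gt0.
  rewrite pfactorK //=.
  rewrite -[X in _ <= X]add0n leq_add2r leqn0 lognE p_pr p1_gt0 /=.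
  by rewrite gtnNdvd // prednK ?prime_gt0.
move/leq_trans; rewrite -muln2 oY expnSr => le_m; apply: leqW.
by rewrite leq_mul ?le_m ?prime_gt1.
Qed.

Lemma index_setI_leq gT (G H K : {group gT}) :
  #|G : H :&: K| <= #|G : H| * #|G : K|.
Proof.
have sGHK: G :&: H :&: K \subset G :&: H := subsetIl _ _.
rewrite -[#|G : H :&: K|]indexgI setIA -(Lagrange_index (subsetIl G H) sGHK) indexgI.
rewrite leq_mul2l [#|_ : G :&: H :&: K|]indexgI; apply/orP; right.
rewrite -(leq_pmul2r (cardG_gt0 K)) !LagrangeMr subset_leq_card //.
by rewrite mulSg ?subsetIl.
Qed.

Lemma index_bigcap_leq gT (I : finType) (P : pred I) (G : {group gT})
    (H : I -> {group gT}) :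
  #|G : \bigcap_(i | P i) H i| <= \prod_(i | P i) #|G : H i|.
Proof.
pose R (A : {set gT}) n := exists2 K : {group gT}, A = K & #|G : K| <= n.
suff [K -> //]: R (\bigcap_(i | P i) H i) (\prod_(i | P i) #|G : H i|)%N.
elim/big_rec2: _ => [|i n A _ [K -> leKn]].
  by exists [set: gT]%G; rewrite // (eqP (_ : #|_ : _| == 1%N)) // indexg_eq1 subsetT.
exists (H i :&: K)%G => //; apply: leq_trans (index_setI_leq _ _ _) _.
by rewrite leq_mul2l leKn orbT.
Qed.

Lemma index_morphpre_sub (aT rT : finGroupType) (D : {group aT})
    (f : {morphism D >-> rT}) (G : {group aT}) (K : {group rT}) :
  G \subset D -> #|G : f @*^-1 K| = #|f @* G : K|.
Proof.
move=> sGD; rewrite -indexgI -[RHS]indexgI -morphim_setIpre.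
rewrite -(index_morphim_ker f (subsetIl _ _) sGD).
rewrite (eqP (_ : #|'ker_G f : _| == 1%N)) ?muln1 // indexg_eq1.
by rewrite subsetI subsetIl subIset // ker_sub_pre orbT.
Qed.

(* [BB] is the set of kernels of the irreducible constituents of [V] under [A].
   The permutation action of [Q] on [BB] has image of order at most [2 ^ #|BB|],
   and its kernel [Q0] acts on each cyclic [A / B] through a group of order at
   most [#|U_ B| / 2]. *)
Lemma pgroup_index_cent_abelian_leq gT (r : nat) (Q V A : {group gT}) :
    r.-group Q -> abelian V -> Q \subset 'N(V) -> coprime #|V| #|Q| ->
    'C_Q(V) = 1 -> abelian A -> A <| Q ->
  #|Q : 'C_Q(A)| <= #|V|.
Proof.
move=> rQ abV nVQ coVQ regQ abA /andP[sAQ nAQ].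
have nVA := subset_trans sAQ nVQ.
have coVA: coprime #|V| #|A| by rewrite (coprime_dvdr (cardSg sAQ)).
pose good (B U : {group gT}) := [&& minnormal U A, U \subset V & 'C_A(U) == B].
pose BB := [set B | [exists U, good B U]].
pose U_ B := odflt 1%G [pick U | good B U].
have goodU B : B \in BB ->
    [/\ minnormal (U_ B) A, U_ B \subset V & 'C_A(U_ B) = B].
  rewrite inE => /existsP[U0 gU0]; rewrite /U_; case: pickP => [U | /(_ U0)].
    by case/and3P=> minU sUV /eqP defB.
  by rewrite gU0.
have inBB (U : {group gT}) : minnormal U A -> U \subset V -> 'C_A(U)%G \in BB.
  by move=> minU sUV; rewrite inE; apply/existsP; exists U; apply/and3P.
have sBA B : B \in BB -> B \subset A by case/goodU=> _ _ <-; apply: subsetIl.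
have actQ: [acts Q, on BB | 'JG].
  apply/subsetP=> y Qy; rewrite !inE /=; apply/subsetP=> B /goodU[minU sUV defB].
  rewrite inE /=; have Ay := normsP nAQ y Qy.
  have <-: ('C_A(U_ B :^ y) = B :^ y)%G.
    by apply: val_inj; rewrite /= -[in RHS]defB conjIg Ay centJ.
  apply: inBB; last by rewrite -(normsP nVQ y Qy) conjSg.
  have [/andP[ntU nUA] minUB] := mingroupP minU.
  apply/mingroupP; split=> [|W /andP[ntW nWA] sWU].
    by rewrite -(inj_eq (@conjsg_inj _ y^-1)) conjsgK conjs1g ntU -Ay normJ conjSg.
  rewrite -(conjsgKV y W); congr (_ :^ y); apply: minUB; last first.
    by rewrite sub_conjgV.
  rewrite -(inj_eq (@conjsg_inj _ y)) conjsgKV conjs1g ntW.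
  by rewrite -(conjsgK y A) Ay normJ conjSg.
pose Q0 := 'C_Q(BB | 'JG)%G; have sQ0Q: Q0 \subset Q := subsetIl _ _.
have nBQ0 B : B \in BB -> Q0 \subset 'N(B).
  move=> Bin; apply/subsetP=> y /setIP[_ /astabP/(_ B Bin) By].
  by apply/normP; rewrite -{2}By.
have nBA B : B \in BB -> A \subset 'N(B).
  by move/sBA=> sB; rewrite cents_norm // (sub_abelian_cent2 abA).
pose D_ (B : {group gT}) := (coset B @*^-1 'C(A / B))%G.
(* A nontrivial [a] does not centralise [V], and by coprimeness it fixes nothing in [[~: V, <[a]>]],
   so it is outside the kernel of any minimal [A]-subgroup found there. *)
have trivBB a : a \in A -> (forall B, B \in BB -> a \in B) -> a = 1.
  move=> Aa inB; apply/eqP; apply: contraT => nta.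
  have sVa: <[a]> \subset 'N(V) by rewrite cycle_subG (subsetP nVA).
  have coVa: coprime #|V| #|<[a]>|.
    by rewrite (coprime_dvdr (cardSg _) coVA) ?cycle_subG.
  have ntW: [~: V, <[a]>] != 1.
    apply: contra nta => /eqP/commG1P; rewrite centsC cycle_subG => cVa.
    by rewrite -in_set1 -[[set 1]]regQ inE (subsetP sAQ).
  have nWA: A \subset 'N([~: V, <[a]>]).
    by rewrite normsR // cents_norm // centsC cycle_subG (subsetP abA).
  have [U minU sUW] := minnormal_exists ntW nWA.
  have [/andP[ntU nUA] _] := mingroupP minU.
  have sUV: U \subset V by rewrite (subset_trans sUW) // commg_subl.
  have /setIP[_ cUa] := inB _ (inBB U minU sUV).
  case/eqP: ntU; apply/trivgP; rewrite -(coprime_abel_cent_TI sVa coVa abV).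
  by rewrite subsetI sUW centsC cycle_subG.
have leQ0 B : B \in BB -> #|Q0 : D_ B|.*2 <= #|U_ B|.
  move=> Bin; have [minU sUV defB] := goodU B Bin.
  have [/andP[ntU nUA] minUB] := mingroupP minU.
  have rQ0 : r.-group Q0 := pgroupS sQ0Q rQ.
  rewrite index_morphpre_sub ?nBQ0 // -indexgI.
  apply: leq_trans (pgroup_index_cent_cyclic _ _ _ _) _.
  - exact: quotient_pgroup rQ0.
  - exact: quotient_pgroup (pgroupS sAQ rQ).
  - rewrite -defB; apply: abelian_minnormal_cyclic => //.
    exact: abelianS abV.
  - by rewrite quotient_norms // (subset_trans sQ0Q).
  rewrite card_quotient ?nBA //; have [x Ux ntx] := trivgPn _ ntU.
  (* [A] being abelian, the points of [U_ B] fixed by the stabiliser of [x] form an [A]-subgroup,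
     hence all of [U_ B]. So [A / B] has a regular orbit avoiding [1], which absorbs the successor
     in [pgroup_index_cent_cyclic]. *)
  suffices defB1: B :=: 'C_A[x].
    rewrite defB1 index_cent1 (cardsD1 1 (U_ B)) group1 ltnS subset_leq_card //.
    apply/subsetP=> _ /imsetP[a Aa ->].
    by rewrite !inE conjg_eq1 ntx memJ_norm // (subsetP nUA).
  have defU: 'C_(U_ B)('C_A[x]) = U_ B.
    apply: minUB (subsetIl _ _); apply/andP; split.
      by apply/trivgPn; exists x => //; rewrite inE Ux -sub_cent1 subsetIr.
    apply: normsI nUA (norms_cent (cents_norm _)).
    exact: sub_abelian_cent2 abA (subxx _) (subsetIl _ _).
  apply/eqP; rewrite -defB eqEsubset; apply/andP; split.
    by rewrite setIS // -cent_set1 centS ?sub1set.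
  by rewrite subsetI subsetIl centsC -defU subsetIr.
have sDC: Q0 :&: \bigcap_(B in BB) D_ B \subset 'C_Q(A).
  apply/subsetP=> y /setIP[Q0y /bigcapP Dy]; have Qy := subsetP sQ0Q y Q0y.
  rewrite inE Qy /=; apply/centP=> a Aa; apply/esym/commgP/eqP.
  apply: trivBB => [|B Bin].
    by rewrite commgEl groupM ?groupV // memJ_norm // (subsetP nAQ).
  have /morphpreP[Ny cy] := Dy B Bin.
  have: [~: A, <[y]>] \subset B.
    by rewrite commGC -quotient_cents2 ?cycle_subG ?nBA // quotient_cycle // cycle_subG.
  by move/subsetP; apply; rewrite mem_commg ?cycle_id.
apply: leq_trans (prod_fixed_leq (BB := BB) (U := U_) abV _ _ _ _ _ _).
- apply: leq_trans (dvdn_leq _ (indexgS Q sDC)) _; first exact: indexg_gt0.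
  rewrite -(Lagrange_index sQ0Q (subsetIl _ _)) [#|Q0 : _|]indexgI.
  have leD := index_bigcap_leq (fun B => B \in BB) Q0 D_.
  apply: leq_trans (leq_mul (pgroup_index_astab_leq rQ actQ) leD) _.
  rewrite -prod_nat_const -big_split /=; apply: leq_prod => B Bin.
  by rewrite mul2n leQ0.
- by move=> B /sBA sB; rewrite (coprime_dvdr (cardSg sB)).
- by move=> B /sBA sB; rewrite (subset_trans sB).
- by move=> B C /sBA sB Cin; rewrite (subset_trans sB) ?nBA.
- move=> B C /sBA sB /goodU[minU _ _]; apply: subset_trans sB _.
  by case/mingroupP: minU => /andP[].
- by move=> B /goodU[_ sUV <-]; rewrite subsetI sUV centsC subsetIr.
- move=> B C Bin /goodU[minU sUV defC]; apply: contraNeq => ntCU.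
  have [/andP[ntU nUA] minUC] := mingroupP minU.
  rewrite -defC subsetI sBA //= centsC.
  rewrite -(minUC 'C_(U_ C)(B)%G _ (subsetIl _ _)) ?subsetIr //= ntCU.
  apply: normsI nUA (norms_cent (cents_norm _)).
  exact: sub_abelian_cent2 abA (subxx _) (sBA B Bin).
Qed.

(** When the next term of the lower central series is central, the three subgroups lemma makes
    ['L_n.+2(Q)] commute with the derived subgroup. It is then abelian and normal in [H], hence
    central, and the descent ends at the derived subgroup. *)
Lemma nilpotent_der1_sub_center gT (H Q : {group gT}) :
    Q <| H -> nilpotent Q ->
    (forall A : {group gT}, A <| H -> A \subset Q -> abelian A ->
      A \subset 'Z(Q)) ->
  Q^`(1) \subset 'Z(Q).
Proof.
move=> nsQH /lcnP[n Ln1] cAZ.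
have: 'L_n.+2(Q) \subset 'Z(Q).
  by rewrite lcnSn Ln1 comm1G sub1G.
elim: n {Ln1} => [|n IHn] LZ; first by rewrite -lcn2.
apply: IHn; apply: cAZ; first 1 last.
- exact: lcn_sub.
- have cQ'L: [~: [~: Q, Q], 'L_n.+2(Q)] = 1.
    apply: three_subgroup.
      apply/commG1P; rewrite (commGC Q) -lcnSn. 
      by rewrite (subset_trans LZ) // subsetIr.
    by apply/commG1P; rewrite -lcnSn (subset_trans LZ) // subsetIr.
  have sLQ': 'L_n.+2(Q) \subset [~: Q, Q] by rewrite lcnSn commSg // lcn_sub.
  by move/commG1P: cQ'L; apply: subset_trans.
exact: char_normal_trans (lcn_char _ _) nsQH.
Qed.

(* Either some [H]-invariant abelian subgroup is noncentral in [Q], and its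
   centraliser lies in [L], or [Q] has class at most two. *)
Lemma normal_pgroup_index_leq gT (r : nat) (H Q V L : {group gT}) :
    r.-group Q -> Q <| H -> abelian V -> Q \subset 'N(V) ->
    coprime #|V| #|Q| -> 'C_Q(V) = 1 ->
    (forall S : {group gT}, S <| H -> S \subset Q -> S :!=: Q -> S \subset L) ->
  #|Q : L| <= #|V|.
Proof.
move=> rQ nsQH abV nVQ coVQ regQ minQ.
have [/existsP[A /and4P[nsAH sAQ abA nAZ]] | ] := boolP
  [exists A : {group gT}, [&& A <| H, A \subset Q, abelian A & ~~ (A \subset 'Z(Q))]].
  have nsAQ: A <| Q by rewrite (normalS sAQ (normal_sub nsQH)).
  apply: leq_trans (pgroup_index_cent_abelian_leq rQ abV nVQ coVQ regQ abA nsAQ).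
  rewrite dvdn_leq ?indexg_gt0 // indexgS // (minQ 'C_Q(A)%G) ?subsetIl //=.
    apply/andP; split; first exact: subset_trans (subsetIl _ _) (normal_sub nsQH).
    by rewrite normsI ?norms_cent ?normal_norm.
  apply: contraNneq nAZ => /setIidPl; rewrite centsC => cQA.
  by rewrite subsetI sAQ.
rewrite negb_exists => /forallP noA.
have [V1 | ntV] := eqsVneq V 1.
  rewrite V1 (eqP (_ : #|_ : _| == 1%N)) ?cards1 // indexg_eq1.
  by rewrite (subset_trans _ (sub1G L)) // -regQ V1 subsetI subxx cents1.
apply: leq_trans (ltnW (class2_index_cent_lt abV ntV nVQ coVQ _)); last first.
  apply: nilpotent_der1_sub_center nsQH (pgroup_nil rQ) _ => A nsAH sAQ abA.
  by have:= noA A; rewrite nsAH sAQ abA negbK.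
by rewrite regQ dvdn_leq ?indexg_gt0 // indexgS ?sub1G.
Qed.

(** * Maximal subgroups and coverings *)

Lemma maximal_sub_eq gT (G M H : {group gT}) :
  maximal M G -> M \subset H -> H \subset G -> H :=: M \/ H :=: G.
Proof.
move=> maxM sMH sHG.
have [|_ /(_ H sMH sHG)//] := maximal_eqP _ _ (_ : maximal_eq M G).
by rewrite /maximal_eq maxM orbT.
Qed.

Section Maximal.

Variable gT : finGroupType.
Implicit Types G H K L M N T V : {group gT}.

Lemma maximal_proper G M : maximal M G -> M \proper G.
Proof. by case/maxgroupP. Qed.

Lemma maximal_sub G M : maximal M G -> M \subset G.
Proof. by move/maximal_proper/proper_sub. Qed.

Lemma maximal_normal_mul G M H :
    maximal M G -> H \subset G -> G \subset 'N(H) -> ~~ (H \subset M) ->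
  H * M = G.
Proof.
move=> maxM sHG nHG nsHM; have sMG := maximal_sub maxM.
have nHM := subset_trans sMG nHG.
have [|eqM|eqG] := @maximal_sub_eq _ G M (H <*> M) maxM (joing_subr _ _).
- by rewrite join_subG sHG.
- by rewrite -eqM joing_subl in nsHM.
by rewrite -norm_joinEr.
Qed.

Lemma maximal_normal_prime G M : maximal M G -> M <| G -> prime #|G : M|.
Proof.
move=> maxM nsMG; have [sMG nMG] := andP nsMG.
have ntGM: G / M != 1.
  by rewrite -subG1 quotient_sub1 //; case/andP: (maximal_proper maxM).
pose p := pdiv #|G / M|.
have p_pr: prime p by rewrite pdiv_prime ?cardG_gt1.
have [x Gx ox] := Cauchy p_pr (pdiv_dvd #|G / M|).
have max1: maximal (M / M) (G / M) by rewrite quotient_maximal.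
have [|||] := @maximal_sub_eq _ (G / M)%G (M / M)%G <[x]>%G max1.
- by rewrite /= trivg_quotient sub1G.
- by rewrite cycle_subG.
- rewrite /= trivg_quotient => /eqP; rewrite cycle_eq1 => /eqP x1.
  by rewrite x1 order1 in ox; rewrite -ox in p_pr.
by move=> /= defG; rewrite -card_quotient // -defG -orderE ox.
Qed.

Lemma der1_sub_maximal_normal G M : maximal M G -> M <| G -> G^`(1) \subset M.
Proof.
move=> maxM nsMG; apply: der1_min; first exact: normal_norm.
apply/cyclic_abelian/prime_cyclic; rewrite card_quotient ?normal_norm //.
exact: maximal_normal_prime.
Qed.

Lemma norm_nonnormal_maximal G M : maximal M G -> ~~ (M <| G) -> 'N_G(M) = M.
Proof.
move=> maxM nnM; have sMG := maximal_sub maxM.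
have [||//|eqG] := @maximal_sub_eq _ G M 'N_G(M)%G maxM.
- by rewrite subsetI sMG normG.
- exact: subsetIl.
by case/negP: nnM; rewrite /normal sMG -{1}eqG subsetIr.
Qed.

Lemma card_orbit_maximal G M :
  maximal M G -> ~~ (M <| G) -> #|orbit 'JG%act G M| = #|G : M|.
Proof.
by move=> maxM nnM; rewrite card_orbit astab1JG norm_nonnormal_maximal.
Qed.

Lemma orbit_maximal G M T : maximal M G -> T \in orbit 'JG%act G M ->
  [/\ maximal T G, (T <| G) = (M <| G) & exists2 x, x \in G & T :=: M :^ x].
Proof.
move=> maxM /imsetP[x Gx ->] /=.
have defG := conjGid Gx; split; last by exists x.
  by rewrite -{1}defG maximalJ.
by rewrite -{1}defG /normal conjSg normJ conjSg.
Qed.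

Lemma max_normal_sub_quotient G N M :
  N <| G -> N \subset M -> maximal M G -> maximal (M / N) (G / N).
Proof.
move=> nsNG sNM maxM; rewrite quotient_maximal //.
exact: normalS sNM (maximal_sub maxM) nsNG.
Qed.

Lemma quotient_normal_eq G N M :
  N <| G -> N \subset M -> M \subset G -> (M / N <| G / N) = (M <| G).
Proof.
move=> nsNG sNM sMG; rewrite -cosetpre_normal !quotientGK //.
exact: normalS nsNG.
Qed.

Lemma gcore_quotient G M : M \subset G ->
  gcore (M / gcore M G) (G / gcore M G) = 1.
Proof.
move=> sMG; set N := gcore M G; have nsNG: N <| G by apply: gcore_normal.
have sNM: N \subset M := gcore_sub _ _.
have /(inv_quotientN nsNG)[K /= defK sNK nsKG] :
  gcore_group (M / N) (G / N) <| G / N by rewrite gcore_normal ?quotientS.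
have nNK: K \subset 'N(N).
  exact: subset_trans (normal_sub nsKG) (normal_norm nsNG).
have sKM: K \subset M.
  by rewrite -(quotientSGK nNK sNM) -defK; apply: gcore_sub.
have: K / N \subset [1] by rewrite quotient_sub1 // gcore_max ?normal_norm.
by rewrite -defK; move/trivgP.
Qed.

(** Structure of a primitive soluble group. [V :&: M] is normalised by [M] and by the abelian [V],
    so minimality makes it trivial; ['C_M(V)] is normal in [G] and lies in the trivial core. *)
Lemma corefree_maximal_sdprod G M :
    solvable G -> maximal M G -> gcore M G = 1 ->
  exists V : {group gT}, [/\ minnormal V G, V \subset G, V ><| M = G, is_abelem V
    & 'C_G(V) = V].
Proof.
move=> solG maxM coreM; have sMG := maximal_sub maxM.
have ntG: G :!=: 1.
  apply: contraTneq (maximal_proper maxM) => G1; rewrite properE sMG G1 /=.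
  by rewrite negbK sub1G.
have [V minV sVG] := minnormal_exists ntG (normG G).
have [nVG ntV abelV] := minnormal_solvable minV sVG solG.
have [/andP[_ _] minVb] := mingroupP minV.
have abV: abelian V := abelem_abelian abelV.
have nsVM: ~~ (V \subset M).
  by apply: contra ntV => sVM; rewrite -subG1 -coreM gcore_max.
have defG: V * M = G := maximal_normal_mul maxM sVG nVG nsVM.
have nVM := subset_trans sMG nVG.
have tiVM: V :&: M = 1.
  apply/eqP; apply: contraNT nsVM => ntVM; apply/setIidPl.
  apply: minVb; rewrite ?subsetIl // ntVM -defG mul_subG //.
    by rewrite cents_norm // (sub_abelian_cent2 abV) ?subsetIl.
  by rewrite normsI ?normG.
exists V; split=> //; first by rewrite sdprodE.
have C1: 'C_M(V) = 1.
  apply/trivgP; rewrite -coreM gcore_max ?subsetIl // -defG mul_subG //.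
    by rewrite cents_norm // centsC subsetIr.
  by rewrite normsI ?normG ?norms_cent.
by rewrite -defG -group_modl -?abelianE // C1 mulg1.
Qed.

(** By minimality [V] lies in the centre of the Fitting subgroup, which it meets nontrivially. As
    [V] is self-centralising, it is the whole Fitting subgroup. *)
Lemma Fitting_minnormal G V N :
    minnormal V G -> V \subset G -> abelian V -> 'C_G(V) = V ->
    N <| G -> nilpotent N ->
  N \subset V.
Proof.
move=> minV sVG abV cVV nsNG nilN.
have [/andP[ntV nVG] minVb] := mingroupP minV.
have sNF: N \subset 'F(G) by apply: Fitting_max.
have sVF: V \subset 'F(G) by rewrite Fitting_max ?abelian_nil // /normal sVG.
have nsVF: V <| 'F(G) by rewrite /normal sVF (subset_trans (Fitting_sub G)).
have ntVZ := meet_center_nil (Fitting_nil G) nsVF ntV.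
have sVZ: V \subset 'Z('F(G)).
  apply/setIidPl/minVb; rewrite ?subsetIl // ntVZ normsI //.
  by rewrite gFnorm_trans // gFnorm.
rewrite -cVV subsetI (normal_sub nsNG) (subset_trans sNF) // centsC.
by rewrite (subset_trans sVZ) // subsetIr.
Qed.

End Maximal.

(** * Covers of a group and of its quotients *)

Section Covering.

Variable gT : finGroupType.
Implicit Types (G H K L M N T V : {group gT}) (C : {set {group gT}}).

Lemma covering_number_leq G C :
  ~~ cyclic G -> proper_cover G C -> covering_number G <= #|C|.
Proof.
move=> ncG coverC; rewrite /covering_number; case: arg_minnP => [|D _]; last exact.
exact: proper_cover_all.
Qed.

Lemma covering_number_attained G :
  ~~ cyclic G -> exists2 C, proper_cover G C & #|C| = covering_number G.
Proof.
move=> ncG; rewrite /covering_number; case: arg_minnP => [|C coverC _].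
  exact: proper_cover_all.
by exists C.
Qed.

Lemma covering_number_maximal G :
  ~~ cyclic G -> exists C, [/\ {in C, forall M : {group gT}, maximal M G},
    \bigcup_(M in C) M = G & #|C| <= covering_number G].
Proof.
move=> ncG; have [C /andP[/forall_inP prC /eqP defG] <-] := covering_number_attained ncG.
pose F H := odflt H [pick M : {group gT} | maximal M G && (H \subset M)].
have FP H : H \in C -> maximal (F H) G /\ H \subset F H.
  move=> /prC prH; rewrite /F; case: pickP => [M /andP[]// | noM].
  have [eqHG | [M maxM sHM]] := maximal_exists (proper_sub prH).
    by rewrite eqHG properxx in prH.
  by have:= noM M; rewrite maxM sHM.
exists [set F H | H in C]; split; last exact: leq_imset_card.
  by move=> _ /imsetP[H /FP[maxM _] ->].
apply/eqP; rewrite eqEsubset; apply/andP; split.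
  by apply/bigcupsP=> _ /imsetP[H /FP[/maximal_sub sFG _] ->].
rewrite -{1}defG; apply/bigcupsP=> H CH.
by rewrite (bigcup_max (F H)) ?imset_f //; case: (FP H CH).
Qed.

End Covering.

Lemma covering_number_quotient gT (G N : {group gT}) :
  N <| G -> ~~ cyclic (G / N) -> covering_number G <= covering_number (G / N).
Proof.
move=> nsNG ncGN.
have [C /andP[/forall_inP prC /eqP defGN] <-] := covering_number_attained ncGN.
have ncG: ~~ cyclic G by apply: contra ncGN; apply: quotient_cyclic.
pose D := [set (coset N @*^-1 H)%G | H : {group coset_of N} in C].
apply: leq_trans (leq_imset_card _ _ : #|D| <= _).
apply: covering_number_leq => //; apply/andP; split.
  apply/forall_inP=> _ /imsetP[H /prC prH ->] /=.
  by rewrite -(quotientGK nsNG) cosetpre_proper.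
rewrite eqEsubset; apply/andP; split; apply/subsetP=> x.
  case/bigcupP=> _ /imsetP[H /prC prH ->] /=; apply/subsetP.
  by rewrite -(quotientGK nsNG) cosetpreSK proper_sub.
move=> Gx; have Nx := subsetP (normal_norm nsNG) x Gx.
have: coset N x \in \bigcup_(H in C) H by rewrite defGN mem_quotient.
case/bigcupP=> H CH Hx; apply/bigcupP; exists (coset N @*^-1 H)%G.
  exact: imset_f.
exact/morphpreP.
Qed.

Lemma num_maximal_quotient gT (G N : {group gT}) :
  N <| G -> num_maximal (G / N) = #|[set M : {group gT} | maximal M G & N \subset M]|.
Proof.
move=> nsNG; rewrite /num_maximal.
pose f (H : {group coset_of N}) := (coset N @*^-1 H)%G.
have injf : injective f.
  by move=> H K [] eqHK; apply: val_inj; rewrite /= -(cosetpreK H) eqHK cosetpreK.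
rewrite -(card_imset _ injf); apply: eq_card => M; rewrite inE.
apply/imsetP/andP=> [[H] | [maxM sNM]].
  rewrite inE => maxH ->; split; last exact: sub_cosetpre.
  by rewrite -(quotientGK nsNG) cosetpre_maximal.
exists (M / N)%G; first by rewrite inE max_normal_sub_quotient.
apply: val_inj; rewrite /= quotientGK //.
exact: normalS sNM (maximal_sub maxM) nsNG.
Qed.

Lemma nonnormal_maximal_noncyclic gT (G M : {group gT}) :
  M \subset G -> ~~ (M <| G) -> ~~ cyclic G.
Proof.
by move=> sMG; apply: contra => /cyclic_abelian abG; rewrite -sub_abelian_normal.
Qed.

(* The cover by [M1] and the cyclic subgroups generated by a nontrivial coset
   of [M1] has the right size without counting all subgroups of order [p]. *)
Lemma covering_number_p2 gT p (G M1 M2 : {group gT}) :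
    prime p -> #|G| = (p ^ 2)%N -> #|M1| = p -> #|M2| = p ->
    M1 \subset G -> M2 \subset G -> M1 :!=: M2 ->
  covering_number G <= p.+1.
Proof.
move=> p_pr oG oM1 oM2 sM1G sM2G neM.
have abG: abelian G := card_p2group_abelian p_pr oG.
have tiM: M1 :&: M2 = 1.
  apply: prime_TIg; first by rewrite oM1.
  by apply: contra neM => sM12; rewrite eqEcard sM12 oM1 oM2 leqnn.
have ncG: ~~ cyclic G.
  apply: contra neM => cycG.
  by rewrite (eq_subG_cyclic cycG) // oM1 oM2.
have lt_pG: p < #|G| by rewrite oG -[X in X < _]expn1 ltn_exp2l ?prime_gt1.
have [a M2a nta]: exists2 a, a \in M2 & a \notin M1.
  apply/subsetPn; apply: contra neM => sM21.
  by rewrite eq_sym eqEcard sM21 oM1 oM2 leqnn.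
pose C := M1 |: [set <[y]>%G | y in a *: M1].
have /leq_trans-> // : covering_number G <= #|C|.
  apply: covering_number_leq => //; apply/andP; split.
    apply/forall_inP=> H /setU1P[-> | /imsetP[y /lcosetP[m M1m ->] ->]].
      by rewrite properEcard sM1G oM1.
    have Gam: a * m \in G by rewrite groupM ?(subsetP sM2G a) ?(subsetP sM1G).
    rewrite properEneq cycle_subG Gam andbT.
    by apply: contraNneq ncG => <-; apply: cycle_cyclic.
  rewrite eqEsubset; apply/andP; split.
    apply/bigcupsP=> H /setU1P[-> // | /imsetP[y /lcosetP[m M1m ->] ->]].
    by rewrite cycle_subG groupM ?(subsetP sM2G a) ?(subsetP sM1G).
  apply/subsetP=> g Gg; have [M1g | nM1g] := boolP (g \in M1).
    by apply/bigcupP; exists M1; rewrite // setU11.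
  have og: #[g] = p.
    have: #[g] %| p ^ 2 by rewrite -oG order_dvdG.
    case/(dvdn_pfactor _ _ p_pr) => [[|[|[|k]]]] // _ og.
      by case/negP: nM1g; rewrite (eqP (_ : g == 1)) // -order_eq1 og.
    case/negP: ncG; apply/cyclicP; exists g; apply/eqP.
    by rewrite eq_sym eqEcard cycle_subG Gg /= -orderE og oG.
  (* [<[g]>] complements [M1], so it meets the coset [a *: M1], and the element found there is
     nontrivial, hence generates [<[g]>]. *)
  have tiMg: M1 :&: <[g]> = 1.
    rewrite setIC; apply: prime_TIg; first by rewrite -orderE og.
    by rewrite cycle_subG.
  have defG: <[g]> * M1 = G.
    apply/eqP; rewrite eqEcard mul_subG ?cycle_subG //=.
    by rewrite TI_cardMg 1?setIC // -orderE og oM1 oG.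
  have: a \in <[g]> * M1 by rewrite defG (subsetP sM2G).
  case/mulsgP=> _ m /cycleP[k ->] M1m def_a.
  have defy: g ^+ k = a * m^-1 by rewrite def_a mulgK.
  apply/bigcupP; exists <[g ^+ k]>%G.
    rewrite /C in_setU1 imset_f ?orbT // defy mem_lcoset mulKg groupV //.
  rewrite /=; suff ->: <[g ^+ k]> = <[g]> by apply: cycle_id.
  have ogk: #[g ^+ k] = p.
    apply: nt_prime_order => //; first by rewrite -expgM mulnC expgM -og expg_order expg1n.
    by rewrite defy; apply: contraNneq nta => /(canRL (mulgKV m)); rewrite mul1g => ->.
  by apply/eqP; rewrite eqEcard cycleX -!orderE ogk og /=.
apply: leq_trans (_ : 1 + #|a *: M1| <= _); last by rewrite card_lcoset oM1.
by rewrite cardsU1 leq_add ?leq_b1 // leq_imset_card.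
Qed.

Section TwoNormalMaximals.

Variables (gT : finGroupType) (G M1 M2 : {group gT}).
Hypotheses (max1 : maximal M1 G) (max2 : maximal M2 G).
Hypotheses (ns1 : M1 <| G) (ns2 : M2 <| G).
Hypotheses (eq_ix : #|G : M1| = #|G : M2|) (neM : M1 :!=: M2).
Let p := #|G : M1|.
Let I := (M1 :&: M2)%G.

Lemma two_normal_maximals_prime : prime p.
Proof. exact: maximal_normal_prime. Qed.

Lemma two_normal_maximals_quotient :
  [/\ I <| G, #|G / I| = (p ^ 2)%N, #|M1 / I| = p, #|M2 / I| = p
    & (M1 / I != M2 / I)].
Proof.
have nsIG: I <| G := normalI ns1 ns2.
have [s1 s2]: I \subset M1 /\ I \subset M2 by rewrite subsetIl subsetIr.
have [sM1 sM2] := (maximal_sub max1, maximal_sub max2).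
have nsM12: ~~ (M1 \subset M2).
  apply: contra neM => sM12; rewrite eqEcard sM12.
  by rewrite -(leq_pmul2r (indexg_gt0 G M1)) {1}eq_ix !Lagrange ?leqnn.
have defG: M2 * M1 = G.
  by rewrite (mulg_normal_maximal ns2 max2).
have oM1: #|M1 : I| = p.
  apply/eqP; rewrite indexgI /p eq_ix -(eqn_pmul2l (cardG_gt0 M2)).
  by rewrite LagrangeMl defG Lagrange.
have oM2: #|M2 : I| = p.
  apply/eqP; rewrite /I /= setIC indexgI -(eqn_pmul2l (cardG_gt0 M1)).
  rewrite LagrangeMl (normC (subset_trans sM1 (normal_norm ns2))) defG.
  by rewrite Lagrange.
have nIG := normal_norm nsIG.
split=> //.
- by rewrite card_quotient // -(Lagrange_index sM1 s1) oM1.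
- by rewrite card_quotient ?(subset_trans sM1).
- by rewrite card_quotient ?(subset_trans sM2).
apply: contra neM => /eqP eqMI; rewrite -(inj_eq val_inj).
by rewrite -(quotientGK (normalS s1 sM1 nsIG)) eqMI quotientGK // (normalS s2 sM2).
Qed.

Lemma two_normal_maximals_noncyclic : ~~ cyclic (G / I).
Proof.
have [_ _ o1 o2] := two_normal_maximals_quotient; apply: contra => cycG.
by rewrite (eq_subG_cyclic cycG) ?quotientS ?maximal_sub // o1 o2.
Qed.

Lemma covering_number_two_normal : covering_number G <= p.+1.
Proof.
have [nsIG oG o1 o2 neMI] := two_normal_maximals_quotient.
apply: leq_trans (covering_number_quotient nsIG two_normal_maximals_noncyclic) _.
apply: (covering_number_p2 two_normal_maximals_prime oG o1 o2) => //.
  by rewrite quotientS ?maximal_sub.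
by rewrite quotientS ?maximal_sub.
Qed.

(** The [p ^ 2 - 1] nontrivial elements of the noncyclic [G / I] are shared among subgroups of order
    [p], each holding [p - 1] of them. *)
Lemma card_normal_maximals_two :
  p < #|[set M : {group gT} | [&& maximal M G, M <| G & #|G : M| == p]]|.
Proof.
have [nsIG oG o1 o2 neMI] := two_normal_maximals_quotient.
have p_pr := two_normal_maximals_prime.
have ncG := two_normal_maximals_noncyclic.
set S := [set M | _].
pose F (x : coset_of I) := (coset I @*^-1 <[x]>)%G.
have oF x : x \in (G / I)^# -> F x \in S.
  case/setD1P=> ntx Gx; rewrite inE.
  have ox: #[x] = p.
    have: #[x] %| p ^ 2 by rewrite -oG order_dvdG.
    case/(dvdn_pfactor _ _ p_pr) => [[|[|[|k]]]] // _ ox.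
      by case/negP: ntx; rewrite -order_eq1 ox.
    case/negP: ncG; apply/cyclicP; exists x; apply/eqP.
    by rewrite eq_sym eqEcard cycle_subG Gx /= -orderE ox oG.
  have sFG: F x \subset G by rewrite -(quotientGK nsIG) cosetpreSK cycle_subG.
  have iF: #|G : F x| = p.
    rewrite -(quotientGK nsIG) index_cosetpre -divgS ?cycle_subG //.
    by rewrite oG -orderE ox mulnK ?prime_gt0.
  rewrite p_index_maximal ?iF //= eqxx andbT.
  rewrite -(quotientGK nsIG) cosetpre_normal -sub_abelian_normal ?cycle_subG //.
  exact: card_p2group_abelian p_pr oG.
rewrite ltnNge; apply/negP=> leSp.
have: #|(G / I)^#| <= \sum_(M in S) p.-1.
  rewrite -sum1_card (partition_big F (mem S) oF) /=.
  apply: leq_sum => M; rewrite inE => /and3P[maxM _ iM].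
  rewrite sum1_card -ltnS prednK ?prime_gt0 //.
  have [sIM | nsIM] := boolP (I \subset M); last first.
    rewrite (eq_card0 (_ : _ =i pred0)) ?prime_gt0 // => x; rewrite !inE.
    by apply: contraNF nsIM => /andP[_ /eqP <-]; apply: sub_cosetpre.
  have oM: #|M / I| = p.
    have sMG := maximal_sub maxM.
    rewrite card_quotient ?(subset_trans sMG (normal_norm nsIG)) //.
    apply/eqP; rewrite -(eqn_pmul2l (indexg_gt0 G M)) Lagrange_index //.
    by rewrite -card_quotient ?normal_norm // oG (eqP iM) mulnn.
  rewrite -oM (cardsD1 1 (M / I)) group1 ltnS subset_leq_card //.
  apply/subsetP=> x; rewrite unfold_in => /andP[/setD1P[ntx Gx] /eqP <-].
  by rewrite !inE ntx /= cosetpreK cycle_id.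
rewrite sum_nat_const => le1; move: oG; rewrite (cardsD1 1) group1 add1n => oG.
have: (p ^ 2 <= (p * p.-1).+1)%N by rewrite -oG ltnS (leq_trans le1) ?leq_mul2r ?leSp ?orbT.
rewrite -[in X in X <= _](prednK (prime_gt0 p_pr)) -mulnn mulnS.
by case: p (prime_gt1 p_pr) => [|[|m]] //=; lia.
Qed.

End TwoNormalMaximals.

Lemma covering_number_corefree_abelian gT (G M V : {group gT}) :
    minnormal V G -> V ><| M = G -> abelian V -> 'C_G(V) = V ->
    abelian M -> M :!=: 1 ->
  covering_number G <= #|V|.+1.
Proof.
move=> minV defG abV cVV abM ntM.
have [nsVG sMG eqG nVM tiVM] := sdprod_context defG.
have [/andP[ntV nVG] minVb] := mingroupP minV.
(* With [M] and [V] abelian, the fixed points of [x] in [V] are normal in [G]. If nontrivial they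
   are all of [V], which puts [x] in ['C_G(V) = V]. *)
have regM: semiregular V M.
  move=> x /setD1P[ntx Mx]; apply: contraNeq ntx => ntC.
  have eqCV: 'C_V[x] = V.
    apply: minVb (subsetIl _ _); rewrite ntC -eqG mul_subG //.
      by rewrite cents_norm // (sub_abelian_cent2 abV) ?subsetIl.
    by rewrite normsI // (subset_trans _ (normG _)) // sub_cent1 (subsetP abM).
  rewrite -in_set1 -[[set 1]]tiVM inE Mx andbT -cVV inE (subsetP sMG) //=.
  by rewrite -sub_cent1 -eqCV subsetIr.
have frobG: [Frobenius G = V ><| M] by apply/Frobenius_semiregularP.
have [_ _ _ prV prM] := Frobenius_context frobG.
have ncG: ~~ cyclic G.
  apply: contra ntM => /cyclic_abelian abG; rewrite -subG1 -tiVM subsetI subxx.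
  by rewrite -cVV subsetI sMG (sub_abelian_cent2 abG) // normal_sub.
pose C := V |: [set (M :^ x)%G | x in V].
apply: leq_trans (_ : #|C| <= _); last first.
  by rewrite cardsU1 -add1n leq_add ?leq_b1 // leq_imset_card.
apply: covering_number_leq => //; apply/andP; split.
  apply/forall_inP=> H /setU1P[-> // | /imsetP[x Vx ->] /=].
  by rewrite -(conjGid (subsetP (normal_sub nsVG) x Vx)) properJ.
rewrite eqEsubset; apply/andP; split.
  apply/bigcupsP=> H /setU1P[-> | /imsetP[x Vx ->] /=]; first exact: normal_sub.
  by rewrite -(conjGid (subsetP (normal_sub nsVG) x Vx)) conjSg.
have /cover_partition<- := Frobenius_partition frobG.
apply/bigcupsP=> A /setU1P[-> | /imsetP[x Vx ->]].
  by rewrite (bigcup_max V) // setU11.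
rewrite (bigcup_max (M :^ x)%G) ?conjSg ?subD1set // in_setU1.
by rewrite imset_f ?orbT.
Qed.

Lemma nonnormal_maximal_quotient gT (G M : {group gT}) (N := gcore M G) :
    maximal M G -> ~~ (M <| G) ->
  [/\ N <| G, N \subset M, maximal (M / N) (G / N), ~~ (M / N <| G / N)
    & #|G / N : M / N| = #|G : M|].
Proof.
move=> maxM nnM; have sMG := maximal_sub maxM.
have nsNG: N <| G := gcore_normal sMG; have sNM: N \subset M := gcore_sub M G.
split=> //; first exact: max_normal_sub_quotient.
  by rewrite quotient_normal_eq.
by rewrite index_quotient_eq ?normal_norm // subIset // sNM orbT.
Qed.

Lemma covering_number_abelian_point gT (G M : {group gT}) :
    solvable G -> maximal M G -> ~~ (M <| G) -> abelian (M / gcore M G) ->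
  covering_number G <= #|G : M|.+1.
Proof.
move=> solG maxM nnM abM.
have [nsNG sNM maxMb nnMb eq_ix] := nonnormal_maximal_quotient maxM nnM.
have sMG := maximal_sub maxM.
have ncGb := nonnormal_maximal_noncyclic (maximal_sub maxMb) nnMb.
apply: leq_trans (covering_number_quotient nsNG ncGb) _.
have [V [minV sVG defG abelV cVV]] :=
  corefree_maximal_sdprod (quotient_sol _ solG) maxMb (gcore_quotient sMG).
have ->: #|G : M| = #|V|.
  by rewrite -eq_ix -divgS ?(maximal_sub maxMb) // -(sdprod_card defG) mulnK.
apply: (covering_number_corefree_abelian minV defG) => //.
  exact: abelem_abelian abelV.
by apply: contraNneq nnMb => ->; apply: normal1.
Qed.

(* An element outside all the given subgroups is built one subgroup at a time,
   multiplying by a [p]-element when it lies in the subgroup of index [p]. *)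
Lemma notin_normal_maximals gT (G : {group gT}) (s : seq {group gT}) :
    {in s, forall M : {group gT}, M <| G /\ prime #|G : M|} ->
    {in s &, forall M1 M2 : {group gT}, #|G : M1| = #|G : M2| -> M1 = M2} ->
  exists2 g, g \in G & {in s, forall M : {group gT}, g \notin M}.
Proof.
elim: s => [|M s IHs] nsM injM; first by exists 1.
have [||g Gg notg] := IHs.
- by move=> M1 sM1; apply: nsM; rewrite inE sM1 orbT.
- by move=> M1 M2 sM1 sM2; apply: injM; rewrite inE ?sM1 ?sM2 orbT.
have [Mg | nMg] := boolP (g \in M); last first.
  by exists g => // M1 /predU1P[-> | /notg].
have [nsMG p_pr] := nsM M (mem_head _ _); set p := #|G : M| in p_pr.
have [P sylP] := Sylow_exists p G.
have nsPM: ~~ (P \subset M).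
  apply/negP=> sPM; have: p^'.-nat p.
    by apply: pnat_dvd (_ : p %| #|G : P|) _; rewrite ?indexgS //; case/and3P: sylP.
  by rewrite p'natE ?dvdnn.
have [x Px nMx] := subsetPn nsPM.
have Gx: x \in G by apply: subsetP Px; apply: pHall_sub sylP.
exists (g * x); first exact: groupM.
move=> M1; rewrite in_cons => /predU1P[-> | sM1]; first by rewrite groupMl.
have [|nsM1 q_pr] := nsM M1; first by rewrite inE sM1 orbT.
have [eqM | neM] := eqVneq M1 M; first by rewrite eqM groupMl.
(* The [p]-element [x] lies in every other listed subgroup, their indices being prime to [p]; so
   correcting [g] at [M] changes no other membership. *)
suffices M1x: x \in M1 by rewrite groupMr //; apply: notg.
have Nx: x \in 'N(M1) by rewrite (subsetP (normal_norm nsM1)).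
apply: coset_idr => //; apply/eqP; rewrite -order_eq1 -dvdn1.
have: coprime p #|G : M1|.
  rewrite prime_coprime // dvdn_prime2 //; apply: contra neM => /eqP eq_ix.
  by apply/eqP/injM; rewrite ?inE ?eqxx ?sM1 ?orbT.
have px: p.-elt x := mem_p_elt (pHall_pgroup sylP) Px.
have: #[coset M1 x] %| #|G : M1|.
  by rewrite -card_quotient ?normal_norm // order_dvdG ?mem_quotient.
have: p.-nat #[coset M1 x] by apply: morph_p_elt.
case/p_natP=> [[|k] ->] // dv.
by rewrite prime_coprime // (dvdn_trans _ dv) ?dvdn_exp.
Qed.

(** * Normal maximal subgroups of distinct indices *)

(** This amounts to a cyclic abelianisation. In this form a failure is at once a pair of subgroups
    for [covering_number_two_normal]. *)
Definition normal_maximals_separated gT (G : {group gT}) :=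
  forall M1 M2 : {group gT}, maximal M1 G -> maximal M2 G ->
    M1 <| G -> M2 <| G -> #|G : M1| = #|G : M2| -> M1 = M2.

Lemma separated_cyclic gT (G : {group gT}) :
    normal_maximals_separated G ->
    (forall M : {group gT}, maximal M G -> M <| G) ->
  cyclic G.
Proof.
move=> sepG nsM; pose s := enum [set M : {group gT} | maximal M G].
have [||g Gg notg] := @notin_normal_maximals gT G s.
- move=> M; rewrite mem_enum inE => maxM.
  by split; [apply: nsM | apply: maximal_normal_prime; rewrite ?nsM].
- move=> M1 M2; rewrite !mem_enum !inE => max1 max2.
  by apply: sepG; rewrite ?nsM.
apply/cyclicP; exists g.
have sgG: <[g]> \subset G by rewrite cycle_subG.
have [-> // | [M maxM]] := maximal_exists sgG; rewrite cycle_subG => Mg.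
by have:= notg M; rewrite mem_enum inE Mg => /(_ maxM).
Qed.

Lemma separated_quotient gT (G N : {group gT}) :
  N <| G -> normal_maximals_separated G -> normal_maximals_separated (G / N).
Proof.
move=> nsNG sepG M1 M2 max1 max2 ns1 ns2 eq_ix.
apply: val_inj; rewrite /= -(cosetpreK M1) -(cosetpreK M2); congr (_ / N).
congr (gval _); apply: (sepG (coset N @*^-1 M1)%G (coset N @*^-1 M2)%G);
  by rewrite /= -(quotientGK nsNG) ?cosetpre_maximal ?cosetpre_normal ?index_cosetpre.
Qed.

Lemma separated_quotient_cyclic gT (G N : {group gT}) :
    N <| G -> normal_maximals_separated G ->
    (forall M : {group gT}, maximal M G -> N \subset M -> M <| G) ->
  cyclic (G / N).
Proof.
move=> nsNG sepG nsM; apply: separated_cyclic; first exact: separated_quotient.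
move=> M maxM; rewrite -cosetpre_normal quotientGK //; apply: nsM.
  by rewrite -(quotientGK nsNG) cosetpre_maximal.
exact: sub_cosetpre.
Qed.

Lemma maximals_normal_nilpotent gT (G : {group gT}) :
  (forall M : {group gT}, maximal M G -> M <| G) -> nilpotent G.
Proof.
move=> nsM; suffices sGF: G \subset 'F(G) by apply: nilpotentS sGF (Fitting_nil G).
rewrite -{1}(Sylow_gen G) gen_subG; apply/bigcupsP=> P /SylowP[p p_pr sylP].
apply: Fitting_max (pgroup_nil (pHall_pgroup sylP)).
have sPG := pHall_sub sylP; rewrite /normal sPG.
have [eqG | [M maxM sNM]] := maximal_exists (subsetIl G 'N(P)).
  by rewrite -eqG subsetIr.
have nsMG := nsM M maxM; have sMG := maximal_sub maxM.
have sPM: P \subset M by rewrite (subset_trans _ sNM) // subsetI sPG normG.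
have sylPM: p.-Sylow(M) P := pHall_subl sPM sMG sylP.
have := Frattini_arg nsMG sylPM.
rewrite mulGSid // => eqMG.
by case/andP: (maximal_proper maxM); rewrite eqMG subxx.
Qed.

(* [H^`(1) :&: gcore T H] lies in the Frattini subgroup, so that the Frattini
   argument makes a Sylow subgroup of [H^`(1)] normal. *)
Lemma single_class_normal_pgroup gT (H T : {group gT}) :
    solvable H -> normal_maximals_separated H -> maximal T H -> ~~ (T <| H) ->
    (forall T1 : {group gT}, maximal T1 H -> ~~ (T1 <| H) ->
      T1 \in orbit 'JG%act H T) ->
  exists r : nat, exists R : {group gT},
    [/\ R <| H, r.-group R & ~~ (R \subset gcore T H)].
Proof.
move=> solH sepH maxT nnT oneT; have sTH := maximal_sub maxT.
have [nsNH sNT maxTb nnTb _] := nonnormal_maximal_quotient maxT nnT.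
pose N := gcore_group T H; have nNH : H \subset 'N(N) := normal_norm nsNH.
have [Vb [minV sVH defHb abelV cVV]] :=
  corefree_maximal_sdprod (quotient_sol _ solH) maxTb (gcore_quotient sTH).
have [nsVHb _ _ _ tiVT] := sdprod_context defHb.
have [V defV sNV nsVH] := inv_quotientN nsNH nsVHb.
have [/andP[ntVb _] _] := mingroupP minV.
(* A nonnormal maximal subgroup above [V] would be conjugate to [T], which does not contain [V]; so
   [H / V] is cyclic. *)
have sH'V: H^`(1) \subset V.
  apply: der1_min (normal_norm nsVH) _; apply: cyclic_abelian.
  apply: (separated_quotient_cyclic nsVH sepH) => T1 max1 sVT1.
  apply: contraT => nn1; case/negP: ntVb; rewrite -subG1.
  have /orbit_maximal-/(_ maxT) := oneT T1 max1 nn1.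
  move=> [_ _ [x Hx eqT1]].
  have sVT: V \subset T.
    by rewrite -(conjSg _ _ x) -eqT1 (normsP (normal_norm nsVH)).
  by rewrite -tiVT subsetI subxx /= defV; apply: quotientS.
have sN0Phi: H^`(1) :&: N \subset 'Phi(H).
  apply/bigcapsP=> M /predU1P[-> | maxM].
    by rewrite subIset // der_sub.
  have [nsM | nnM] := boolP (M <| H).
    by rewrite subIset // der1_sub_maximal_normal.
  have [_ _ [x Hx ->]] := orbit_maximal maxT (oneT M maxM nnM).
  by rewrite subIset // -(normsP nNH x Hx) conjSg sNT orbT.
have /is_abelemP[r r_pr abelVr] := abelV.
have [R sylR] := Sylow_exists r H^`(1).
have sRH' := pHall_sub sylR; have sH'H: H^`(1) \subset H := der_sub 1 H.
have sN0H': H^`(1) :&: N \subset H^`(1) := subsetIl _ _.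
have rN0: r.-nat #|H^`(1) : H^`(1) :&: N|.
  rewrite indexgI -card_quotient ?(subset_trans sH'H) //.
  by apply: pgroupS (abelem_pgroup abelVr); rewrite defV quotientS.
have eqH': (H^`(1) :&: N) * R = H^`(1).
  apply: coprime_index_mulG => //; apply: pnat_coprime rN0 _.
  by case/and3P: sylR.
have nsRH: R <| H.
  have /= := Frattini_arg (der_normal 1 H) sylR.
  rewrite -eqH' -mulgA [R * _]mulSGid; last first.
    by rewrite subsetI (subset_trans sRH') ?normG.
  move=> eqH; have: 'Phi(H) <*> 'N_H(R) = H.
    apply/eqP; rewrite eqEsubset join_subG Phi_sub subsetIl -{1}eqH /=.
    by rewrite mul_subG ?joing_subr // (subset_trans sN0Phi) ?joing_subl.
  move/Phi_nongen; rewrite genGid => eqN.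
  by rewrite /normal (subset_trans sRH') // -{1}eqN subsetIr.
exists r, R; split=> //; first exact: pHall_pgroup sylR.
(* If [R] lay in the core, so would the derived subgroup, and the primitive quotient would be
   abelian with [T / gcore T H] normal. *)
apply: contra nnTb => sRN; rewrite -sub_abelian_normal ?quotientS //.
by rewrite sub_der1_abelian // -eqH' mul_subG // subsetIr.
Qed.

(** * Lower bound for the index of a nonnormal maximal subgroup *)

Lemma order_leq_of_nontrivial_action gT (V : {group gT}) x :
  x \in 'N(V) -> prime #[x] -> x \notin 'C(V) -> #[x] <= #|V|.
Proof.
move=> nVx x_pr; rewrite -sub_cent1 => /subsetPn[y Vy ncy].
have reg: 'C_<[x]>[y] = 1.
  by apply: prime_TIg => //; rewrite cycle_subG cent1C.
rewrite orderE -(indexg1 <[x]>) -reg index_cent1 subset_leq_card //.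
apply/subsetP=> _ /imsetP[z zx ->]; rewrite memJ_norm //.
by apply: subsetP zx; rewrite cycle_subG.
Qed.

Lemma card_two_orbits_leq gT (G M1 M2 : {group gT}) :
    maximal M1 G -> ~~ (M1 <| G) -> maximal M2 G -> ~~ (M2 <| G) ->
    M2 \notin orbit 'JG%act G M1 ->
  #|G : M1| + #|G : M2| <= #|[set M : {group gT} | maximal M G & ~~ (M <| G)]|.
Proof.
move=> max1 nn1 max2 nn2 no12.
rewrite -(card_orbit_maximal max1 nn1) -(card_orbit_maximal max2 nn2).
rewrite -cardsUI [X in _ + X](_ : _ = 0).
  rewrite addn0 subset_leq_card //; apply/subsetP=> M.
  case/setUP=> [/(orbit_maximal max1) | /(orbit_maximal max2)] [maxM nsM _];
    by rewrite inE maxM nsM.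
apply/eqP; rewrite cards_eq0; apply: contraR no12 => /set0Pn[M /setIP[o1 o2]].
by rewrite -(orbit_eqP o1) orbit_sym.
Qed.

(* A normal [r]-subgroup of [H] not contained in the core of [T] covers the
   socle of the primitive group [H / gcore T H]. *)
Lemma card_normal_pgroup_quotient gT (r : nat) (H T Q : {group gT}) :
    solvable H -> maximal T H -> ~~ (T <| H) -> Q <| H -> r.-group Q ->
    ~~ (Q \subset gcore T H) ->
  #|Q : gcore T H| = #|H : T|.
Proof.
move=> solH maxT nnT nsQH rQ nsQN; have sTH := maximal_sub maxT.
have [nsNH sNT maxTb nnTb eq_ix] := nonnormal_maximal_quotient maxT nnT.
have [Vb [minV sVH defHb abelV cVV]] :=
  corefree_maximal_sdprod (quotient_sol _ solH) maxTb (gcore_quotient sTH).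
have nNQ := subset_trans (normal_sub nsQH) (normal_norm nsNH).
have nsQb := quotient_normal (gcore T H) nsQH.
have sQV: Q / gcore T H \subset Vb.
  apply: (Fitting_minnormal minV sVH (abelem_abelian abelV) cVV nsQb).
  exact/quotient_nil/(pgroup_nil rQ).
have [_ minVb] := mingroupP minV.
have eqQV: Q / gcore T H = Vb.
  apply: minVb sQV; rewrite -subG1 quotient_sub1 //.
  by rewrite nsQN normal_norm.
rewrite -(card_quotient nNQ) eqQV -eq_ix -divgS ?(maximal_sub maxTb) //.
by rewrite -(sdprod_card defHb) mulnK.
Qed.

Lemma normal_pgroup_index_leq_socle gT (r : nat) (G M V : {group gT})
    (T R : {group coset_of V}) :
    solvable G -> minnormal V G -> V ><| M = G -> is_abelem V ->
    'C_G(V) = V -> maximal T (G / V) -> ~~ (T <| G / V) ->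
    R <| G / V -> r.-group R -> ~~ (R \subset gcore T (G / V)) ->
  #|G / V : T| <= #|V|.
Proof.
move=> solG minV defG abelV cVV maxT nnT nsR rR nsRN.
have [nsVG sMG eqG nVM tiVM] := sdprod_context defG.
have [/andP[ntV nVG] minVb] := mingroupP minV.
have abV: abelian V := abelem_abelian abelV.
(* Minimality of [Q] forces smaller normal subgroups into the core, as the last hypothesis of
   [normal_pgroup_index_leq] requires. *)
have [|Q] := @ex_mingroup _
  (fun Q => [&& Q <| G / V, Q \subset R & ~~ (Q \subset gcore T (G / V))]).
  by exists R; rewrite nsR subxx nsRN.
case/mingroupP=> /and3P[nsQ sQR nsQN] minQ.
have rQ: r.-group Q := pgroupS sQR rR.
rewrite -(card_normal_pgroup_quotient (quotient_sol _ solG) maxT nnT nsQ rQ nsQN).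
pose K := (coset V @*^-1 Q)%G; pose QM := (M :&: K)%G.
have nVK: K \subset 'N(V) := subsetIl _ _.
have sKG: K \subset G by rewrite -(quotientGK nsVG) cosetpreSK normal_sub.
have nsKG: K <| G by rewrite -(quotientGK nsVG) cosetpre_normal.
have nsQM: QM <| M := normalGI sMG nsKG.
have sQM: QM \subset M := subsetIl _ _.
have eqK: V * QM = K by rewrite group_modl ?eqG ?(setIidPr sKG) ?sub_cosetpre.
have defQ: QM / V = Q by rewrite -quotientMidl eqK cosetpreK.
have tiQM: V :&: QM = 1 by apply/trivgP; rewrite -tiVM setIS.
have nVQM: QM \subset 'N(V) := subset_trans sQM nVM.
have rQM: r.-group QM.
  by rewrite /pgroup (card_isog (quotient_isog nVQM tiQM)) /= defQ.
rewrite -defQ -index_morphpre_sub //.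
apply: (normal_pgroup_index_leq rQM nsQM abV nVQM) => /=.
- have /is_abelemP[p p_pr abelVp] := abelV; have pV := abelem_pgroup abelVp.
  (* If [r] were the prime [p] of [V], the preimage [K] would be a normal [p]-subgroup of [G], hence
     inside [V], and [Q] would be trivial. *)
  have [eq_rp | ne_rp] := eqVneq r p; last first.
    by apply: pnat_coprime pV (sub_in_pnat _ rQM) => q _; rewrite !inE => /eqP->.
  suff Q1: Q :=: 1 by rewrite Q1 sub1G in nsQN.
  apply/trivgP; rewrite -defQ -quotientMidl eqK quotient_sub1 //.
  apply: Fitting_minnormal minV (normal_sub nsVG) abV cVV nsKG _.
  apply: (pgroup_nil (p := p)).
  by rewrite /= -eqK pgroupM pV -eq_rp.
- apply/trivgP/subsetP=> x /setIP[QMx cVx]; have Mx := subsetP sQM x QMx.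
  have Vx: x \in V by rewrite -cVV inE (subsetP sMG).
  by rewrite -tiVM inE Vx.
move=> S nsSM sSQ neSQ; have sSM := normal_sub nsSM.
have nVS: S \subset 'N(V) := subset_trans sSM nVM.
rewrite -sub_quotient_pre //; apply: contraR neSQ => nsSN.
have sSbQ: S / V \subset Q by rewrite -defQ quotientS.
have eqSQ: S / V = Q.
  apply: (minQ (S / V)%G _ sSbQ); rewrite nsSN (subset_trans sSbQ) // andbT.
  by rewrite -eqG quotientMidl quotient_normal.
rewrite eqEcard sSQ (card_isog (quotient_isog nVQM tiQM)) /= defQ -eqSQ.
by rewrite leq_quotient.
Qed.

Lemma covering_number_gt0 gT (G : {group gT}) : ~~ cyclic G -> 0 < covering_number G.
Proof.
move=> ncG; have [C /andP[_ /eqP defG] <-] := covering_number_attained ncG.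
rewrite card_gt0; apply: contraNneq ncG => C0; rewrite C0 big_set0 in defG.
by have := group1 G; rewrite -defG inE.
Qed.

Lemma num_maximal_quotient_orbit gT (G M N : {group gT}) :
    maximal M G -> ~~ (M <| G) -> N <| G -> ~~ (N \subset M) ->
  num_maximal (G / N) + #|G : M| <= num_maximal G.
Proof.
move=> maxM nnM nsNG nsNM.
rewrite num_maximal_quotient // -(card_orbit_maximal maxM nnM) -cardsUI.
rewrite [X in _ + X](_ : _ = 0).
  rewrite addn0 subset_leq_card //; apply/subsetP=> T.
  case/setUP=> [|/(orbit_maximal maxM)[maxT _ _]]; rewrite !inE //.
  by case/andP.
apply/eqP; rewrite cards_eq0; apply: contraR nsNM => /set0Pn[T /setIP[]].
rewrite inE => /andP[_ sNT] /(orbit_maximal maxM)[_ _ [x Gx eqT]].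
by rewrite -(conjSg _ _ x) (normsP (normal_norm nsNG)) // -eqT.
Qed.

Lemma num_maximal_quotient_leq gT (G N : {group gT}) :
  N <| G -> num_maximal (G / N) <= num_maximal G.
Proof.
move=> nsNG; rewrite num_maximal_quotient // subset_leq_card //.
by apply/subsetP=> M; rewrite !inE => /andP[].
Qed.

Lemma maximal_index_geq_corefree gT (G M : {group gT}) :
    (forall (hT : finGroupType) (H T : {group hT}), #|H| < #|G| ->
      solvable H -> num_maximal H < (covering_number H).*2 ->
      maximal T H -> ~~ (T <| H) -> covering_number H <= #|H : T|.+1) ->
    solvable G -> num_maximal G < (covering_number G).*2 ->
    maximal M G -> ~~ (M <| G) -> gcore M G = 1 -> ~~ abelian M ->
  covering_number G <= #|G : M|.+1.
Proof.
move=> IH solG leG maxM nnM coreM nabM; rewrite leqNgt; apply/negP=> ltG.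
have sMG := maximal_sub maxM.
have [V [minV sVG defG abelV cVV]] := corefree_maximal_sdprod solG maxM coreM.
have [nsVG _ eqG nVM tiVM] := sdprod_context defG.
have [/andP[ntV nVG] minVb] := mingroupP minV.
have V_gt1: 1 < #|V| by rewrite cardG_gt1.
have oV: #|G : M| = #|V| by rewrite -divgS // -(sdprod_card defG) mulnK.
pose H := (G / V)%G.
have isoMH: M \isog H := sdprod_isog defG.
have solH: solvable H := quotient_sol V solG.
have nabH: ~~ abelian H by rewrite -(isog_abelian isoMH).
have ncH: ~~ cyclic H by apply: contra nabH; apply: cyclic_abelian.
have leGH: covering_number G <= covering_number H by apply: covering_number_quotient.
have nsVM: ~~ (V \subset M).
  by apply: contra ntV => sVM; rewrite -subG1 -tiVM subsetI subxx.
have le_num: num_maximal H + #|V| <= num_maximal G.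
  by rewrite -oV; apply: num_maximal_quotient_orbit.
have H_gt0 := covering_number_gt0 ncH.
have leH: num_maximal H < (covering_number H).*2.
  by clear - leG le_num leGH; lia.
have ltHG: #|H| < #|G|.
  by rewrite -(card_isog isoMH) -(sdprod_card defG) ltn_Pmull.
have IHH (T : {group _}) : maximal T H -> ~~ (T <| H) -> covering_number H <= #|H : T|.+1.
  by move=> maxT nnT; apply: IH.
(* Otherwise [covering_number H <= p + 1] for a prime [p] dividing [#|M|]; an element of order [p]
   of the faithful group [M] has an orbit of length [p] on [V], so [p <= #|V|]. *)
have sepH: normal_maximals_separated H.
  move=> M1 M2 max1 max2 ns1 ns2 eq_ix; apply/eqP; apply: contraT => neM.
  have le_p := covering_number_two_normal max1 max2 ns1 ns2 eq_ix neM.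
  have p_pr := maximal_normal_prime max1 ns1.
  have: #|H : M1| %| #|M| by rewrite (card_isog isoMH) dvdn_indexg.
  case/(Cauchy p_pr) => x Mx ox.
  have: #[x] <= #|V|.
    apply: order_leq_of_nontrivial_action; rewrite ?ox ?(subsetP nVM) //.
    apply: contraTN p_pr => cVx; have Vx: x \in V.
      by rewrite -cVV inE (subsetP sMG).
    have: x \in V :&: M by rewrite inE Vx.
    by rewrite tiVM => /set1P x1; rewrite -ox x1 order1.
  by rewrite ox; clear - le_p leGH ltG oV; lia.
have [/existsP[T /andP[maxT nnT]] | ] :=
  boolP [exists T : {group _}, maximal T H && ~~ (T <| H)]; last first.
  rewrite negb_exists => /forallP allN; case/negP: ncH.
  apply: separated_cyclic => // T maxT.
  by have:= allN T; rewrite maxT negbK.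
have leT := IHH T maxT nnT.
(* Two classes contribute at least [2 * (covering_number H - 1)]. The class of [M], invisible in
   [H], adds [#|V| >= 2], so [num_maximal G] reaches the forbidden [2 * covering_number G]. *)
have oneT (T1 : {group _}) : maximal T1 H -> ~~ (T1 <| H) -> T1 \in orbit 'JG%act H T.
  move=> max1 nn1; apply: contraT => no1; have le1 := IHH T1 max1 nn1.
  have := card_two_orbits_leq maxT nnT max1 nn1 no1.
  suff: #|[set K : {group _} | maximal K H & ~~ (K <| H)]| <= num_maximal H.
    by clear - leG leT le1 le_num leGH V_gt1; lia.
  by rewrite subset_leq_card //; apply/subsetP=> K; rewrite !inE => /andP[].
have [r [R [nsR rR nsRN]]] := single_class_normal_pgroup solH sepH maxT nnT oneT.
have leV: #|H : T| <= #|V|.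
  exact: normal_pgroup_index_leq_socle solG minV defG abelV cVV maxT nnT nsR rR nsRN.
by clear - leV leT leGH ltG oV; lia.
Qed.

Lemma maximal_index_geq gT (G M : {group gT}) :
    solvable G -> num_maximal G < (covering_number G).*2 ->
    maximal M G -> ~~ (M <| G) ->
  covering_number G <= #|G : M|.+1.
Proof.
move: {2}#|G|.+1 (ltnSn #|G|) => n.
elim: n => // n IHn in gT G M *; rewrite ltnS => leGn solG leG maxM nnM.
have [nsNG sNM maxMb nnMb eq_ix] := nonnormal_maximal_quotient maxM nnM.
have sMG := maximal_sub maxM.
have ncGb := nonnormal_maximal_noncyclic (maximal_sub maxMb) nnMb.
have leGb := covering_number_quotient nsNG ncGb.
have [abM | nabM] := boolP (abelian (M / gcore M G)).
  exact: covering_number_abelian_point.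
apply: (leq_trans leGb); rewrite -eq_ix.
apply: maximal_index_geq_corefree => //; first 1 last.
- exact: quotient_sol.
- apply: leq_ltn_trans (num_maximal_quotient_leq nsNG) _.
  by rewrite (leq_trans leG) // leq_double.
- exact: gcore_quotient.
move=> hT H T ltH; apply: IHn.
by apply: leq_trans ltH (leq_trans (leq_quotient _ _) leGn).
Qed.

(** * A minimal cover restricted to a chief factor *)

Lemma leq_card_bigcup (I T : finType) (P : pred I) (F : I -> {set T}) :
  #|\bigcup_(i | P i) F i| <= \sum_(i | P i) #|F i|.
Proof.
elim/big_rec2: _ => [|i n A _ leA]; first by rewrite cards0.
by rewrite (leq_trans (leq_card_setU _ _)) // leq_add2l.
Qed.

(** A pair is returned because, under [normal_maximals_separated], two distinct maximal subgroups of
    equal index cannot both be normal; then [M1] is nonnormal. *)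
Lemma small_maximals gT (G : {group gT}) :
    solvable G -> ~~ cyclic G ->
  exists M1 M2 : {group gT},
    [/\ maximal M1 G, maximal M2 G, M1 :!=: M2, M1 <| G -> M2 <| G
      & #|G : M1| = #|G : M2| /\ #|G : M1| < covering_number G].
Proof.
move=> solG ncG; have [C [maxC coverC leC]] := covering_number_maximal ncG.
(* [X] is taken as large as possible with the members above it still covering [G]. For a chief
   factor [Y / X], the members above [Y] then miss some [g]. *)
pose P (X : {group gT}) :=
  (X <| G) && (G \subset \bigcup_(M in C | X \subset gval M) M).
have [|X /maxgroupP[/andP[nsXG coverX] maxX]] := @ex_maxgroup _ P.
  exists 1%G; rewrite /P normal1 -{1}coverC; apply/bigcupsP=> M CM.
  by rewrite (bigcup_max M) // CM sub1G.
have nXG := normal_norm nsXG.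
have ntGX: G / X != 1.
  rewrite -subG1 quotient_sub1 //; apply/negP=> sGX.
  have /bigcupP[M /andP[CM sXM] _] := subsetP coverX 1 (group1 G).
  by have /andP[_ /negP[]] := maximal_proper (maxC M CM); apply: subset_trans sXM.
have [Yb minYb sYbG] := minnormal_exists ntGX (normG _).
have [nYbG ntYb abelYb] := minnormal_solvable minYb sYbG (quotient_sol X solG).
have [_ minY] := mingroupP minYb.
have [Y defY sXY nsYG] := inv_quotientN nsXG (introT andP (conj sYbG nYbG)).
have nYG := normal_norm nsYG; have sYG := normal_sub nsYG.
have nXY := subset_trans sYG nXG.
have sY'X: [~: Y, Y] \subset X.
  by rewrite -quotient_cents2 // -defY; apply: abelem_abelian abelYb.
have neXY: ~~ (Y \subset X).
  by apply: contra ntYb => sYX; rewrite defY -subG1 quotient_sub1.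
pose C1 := [set M in C | (X \subset gval M) && ~~ (Y \subset gval M)].
have C1P M : M \in C1 -> [/\ maximal M G, Y * M = G & M :&: Y = X].
  rewrite inE => /and3P[/maxC maxM sXM nsYM]; have sMG := maximal_sub maxM.
  have defG := maximal_normal_mul maxM sYG nYG nsYM.
  have sXMY: X \subset M :&: Y by rewrite subsetI sXM.
  have nMY: G \subset 'N(M :&: Y).
    rewrite -defG mul_subG //.
      rewrite -commg_subr (subset_trans _ sXMY) // (subset_trans _ sY'X) //.
      by rewrite commgS ?subsetIr.
    by rewrite normsI ?normG // (subset_trans sMG).
  split=> //; apply/eqP; rewrite eqEsubset sXMY andbT.
  rewrite -quotient_sub1 ?(subset_trans (subsetIr _ _)) // subG1.
  apply: contraR nsYM => ntMY.
  have eqMY: (M :&: Y) / X = Yb.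
    apply: (minY ((M :&: Y) / X)%G); last by rewrite defY quotientS ?subsetIr.
    by rewrite ntMY quotient_norms.
  have: Y / X \subset M / X by rewrite -defY -eqMY quotientS ?subsetIl.
  by rewrite quotientSGK.
have oC1 M : M \in C1 -> #|G : M| = #|Y : X|.
  case/C1P=> /maximal_sub sMG defG tiMY.
  apply/eqP; rewrite -tiMY setIC indexgI -(eqn_pmul2l (cardG_gt0 M)) Lagrange //.
  by rewrite LagrangeMl (normC (subset_trans sMG nYG)) defG.
have [g Gg notg]: exists2 g, g \in G & g \notin \bigcup_(M in C | Y \subset gval M) M.
  apply/subsetPn; apply: contra neXY => coverY.
  by rewrite (maxX Y) // /P nsYG.
(* A member above [Y] meeting [g *: Y] would contain [g]. So [C1] alone covers this coset, and each
   of its members meets it in at most one coset of [X]. *)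
have leYX: #|Y : X| <= #|C1|.
  rewrite -(leq_pmul2r (cardG_gt0 X)) mulnC Lagrange // -(card_lcoset Y g).
  have coset_cover: g *: Y \subset \bigcup_(M in C1) (M :&: (g *: Y)).
    apply/subsetP=> h gYh; have Gh: h \in G.
      by case/lcosetP: gYh => y Yy ->; rewrite groupM // (subsetP sYG).
    have /bigcupP[M /andP[CM sXM] Mh] := subsetP coverX h Gh.
    apply/bigcupP; exists M; last by rewrite inE Mh.
    rewrite inE CM sXM; apply: contra notg => sYM; apply/bigcupP.
    exists M; rewrite ?CM //; case/lcosetP: gYh Mh => y /(subsetP sYM) My ->.
    by rewrite groupMr.
  apply: leq_trans (subset_leq_card coset_cover) _.
  apply: leq_trans (leq_card_bigcup _ _) _.
  rewrite -sum_nat_const; apply: leq_sum => M /C1P[_ _ tiMY].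
  have [-> | [u /setIP[Mu gYu]]] := set_0Vmem (M :&: g *: Y); first by rewrite cards0.
  rewrite -(card_lcoset X u) subset_leq_card //; apply/subsetP=> w /setIP[Mw gYw].
  rewrite mem_lcoset -tiMY inE groupM ?groupV //=.
  have [y Yy ->] := lcosetP gYu; have [z Yz ->] := lcosetP gYw.
  by rewrite invMg mulgA mulgKV groupM ?groupV.
(* Members of [C1] meet [Y] only in [X], so covering [Y] takes at least one further member. *)
have ltC1: #|C1| < #|C|.
  rewrite proper_card // properE; apply/andP; split.
    by apply/subsetP=> M; rewrite inE => /andP[].
  have [y Yy nXy] := subsetPn neXY.
  have: y \in \bigcup_(M in C) M by rewrite coverC (subsetP sYG).
  case/bigcupP=> M CM My; apply: contra nXy => /subsetP/(_ M CM)/C1P[_ _ <-].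
  by rewrite inE My.
have lt1: 1 < #|C1| by apply: leq_trans leYX; rewrite indexg_gt1.
have [M1 [M2 [C1M1 C1M2 neM]]]: exists M1, exists M2, [/\ M1 \in C1, M2 \in C1 & M1 != M2].
  exact/card_gt1P.
have [[max1 defG1 ti1] [max2 defG2 ti2]] := (C1P M1 C1M1, C1P M2 C1M2).
exists M1, M2; split=> //; last first.
  rewrite !oC1 //; split=> //; apply: leq_ltn_trans leYX _.
  exact: leq_trans ltC1 leC.
(* A normal complement [M1] makes the chief factor [Y / X] central, and then every complement is
   normalised by [Y]. *)
move=> ns1; rewrite /normal maximal_sub // -defG2 mul_subG ?normG //.
have sRX: [~: Y, G] \subset X.
  rewrite commGC -quotient_cents2 // -{1}defG1 quotientMl // mul_subG //.
    by rewrite quotient_cents2.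
  rewrite quotient_cents2 ?(subset_trans (maximal_sub max1)) // -ti1 subsetI.
  rewrite commg_subl (subset_trans sYG) ?normal_norm //=.
  by rewrite commg_subr (subset_trans (maximal_sub max1)).
rewrite -commg_subr (subset_trans (commgS _ (maximal_sub max2))) //.
by rewrite (subset_trans sRX) // -ti2 subsetIl.
Qed.

(** * Structure modulo the Frattini subgroup *)

Lemma nonnormal_maximal_socle gT (G T : {group gT}) :
    solvable G -> maximal T G -> ~~ (T <| G) ->
  exists V : {group gT},
    [/\ [/\ V <| G, gcore T G \subset V & V :&: T = gcore T G],
        is_abelem (V / gcore T G), minnormal (V / gcore T G) (G / gcore T G),
        'C_(G / gcore T G)(V / gcore T G) = V / gcore T G
      & #|V / gcore T G| = #|G : T|].
Proof.
move=> solG maxT nnT; have sTG := maximal_sub maxT.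
have [nsNG sNT maxTb nnTb eq_ix] := nonnormal_maximal_quotient maxT nnT.
have [Vb [minV sVG defG abelV cVV]] :=
  corefree_maximal_sdprod (quotient_sol _ solG) maxTb (gcore_quotient sTG).
have [nsVb _ _ _ tiVT] := sdprod_context defG.
have [V defV sNV nsV] := inv_quotientN nsNG nsVb.
exists V; rewrite -defV; split=> //; last first.
  by rewrite -eq_ix -divgS ?(maximal_sub maxTb) // -(sdprod_card defG) mulnK.
split=> //; apply/eqP; rewrite eqEsubset subsetI sNV sNT andbT.
have nNV: V :&: T \subset 'N(gcore T G).
  by rewrite (subset_trans (subsetIr _ _)) // (subset_trans sTG) ?gcore_norm.
rewrite -quotient_sub1 // -tiVT subsetI defV !quotientS ?subsetIl //.
exact: subsetIr.
Qed.

Lemma num_maximal_cyclic gT (C : {group gT}) :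
  cyclic C -> num_maximal C = size (primes #|C|).
Proof.
move=> cycC; have abC := cyclic_abelian cycC.
rewrite /num_maximal cardE -(size_map (fun M : {group gT} => #|C : M|)).
apply/perm_size/uniq_perm; rewrite ?primes_uniq //.
  rewrite map_inj_in_uniq ?enum_uniq // => M1 M2.
  rewrite !mem_enum !inE => /maximal_sub sM1 /maximal_sub sM2 eq_ix.
  apply/eqP; rewrite -val_eqE /= (eq_subG_cyclic cycC) //.
  by rewrite -(eqn_pmul2r (indexg_gt0 C M1)) {2}eq_ix !Lagrange.
move=> p; apply/mapP/idP => [[M] | ].
  rewrite mem_enum inE => maxM ->; rewrite mem_primes cardG_gt0 dvdn_indexg.
  by rewrite maximal_normal_prime // -sub_abelian_normal ?maximal_sub.
rewrite mem_primes => /and3P[p_pr _ dvpC].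
have [x defC] := cyclicP cycC.
have sxC: <[x ^+ p]> \subset C by rewrite defC cycleX.
have ix: #|C : <[x ^+ p]>| = p.
  rewrite -divgS // -orderE orderXdiv; last by rewrite orderE -defC.
  rewrite orderE -defC divnA // mulKn //.
exists <[x ^+ p]>%G; rewrite // mem_enum inE p_index_maximal //= ix //.
Qed.

Lemma num_normal_maximals gT (G : {group gT}) :
  #|[set M : {group gT} | maximal M G & M <| G]| = num_maximal (G / G^`(1)).
Proof.
rewrite num_maximal_quotient ?der_normal //; apply: eq_card => M; rewrite !inE.
case maxM: (maximal M G) => //=; apply/idP/idP => [nsM | sG'M].
  exact: der1_sub_maximal_normal.
exact: sub_der1_normal sG'M (maximal_sub maxM).
Qed.

Lemma num_maximal_split gT (G : {group gT}) :
  num_maximal G = #|[set M : {group gT} | maximal M G & M <| G]|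
    + #|[set M : {group gT} | maximal M G & ~~ (M <| G)]|.
Proof.
rewrite /num_maximal -(cardsID [set M : {group gT} | M <| G]).
by congr (_ + _); apply: eq_card => M; rewrite !inE // andbC.
Qed.

Lemma card_cent_dvdn_Aut gT (A E : {group gT}) :
  A \subset 'N(E) -> #|A : 'C_A(E)| %| #|Aut E|.
Proof.
move=> nEA; have <-: #|conj_aut E @* A| = #|A : 'C_A(E)|.
  by rewrite card_morphim ker_conj_aut (setIidPr nEA) indexgI.
exact: cardSg (Aut_conj_aut _ _).
Qed.

(** Two normal maximal subgroups of index [r] give more than [r] of them and
    [covering_number G <= r + 1], while the class of [T] has at least [covering_number G - 1]
    members. Hence all counts are tight: the socle factor [V / gcore T G] has prime order [r], and
    [#|G : V|] divides [r - 1]. But any maximal subgroup above [V] is normal, of index [r]. *)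
Lemma separated_of_num_maximal gT (G T : {group gT}) :
    solvable G -> maximal T G -> ~~ (T <| G) ->
    num_maximal G = (2 * covering_number G - 1)%N ->
  normal_maximals_separated G.
Proof.
move=> solG maxT nnT oG M1 M2 max1 max2 ns1 ns2 eq_ix.
apply/eqP; apply: contraT => neM.
have ncG := nonnormal_maximal_noncyclic (maximal_sub maxT) nnT.
have s_gt0 := covering_number_gt0 ncG.
have leT: covering_number G <= #|G : T|.+1.
  by apply: maximal_index_geq => //; rewrite oG; clear - s_gt0; lia.
have le_r := covering_number_two_normal max1 max2 ns1 ns2 eq_ix neM.
have lt_r := card_normal_maximals_two max1 max2 ns1 ns2 eq_ix neM.
have r_pr := maximal_normal_prime max1 ns1.
set r := #|G : M1| in le_r lt_r r_pr.
have leNN: #|G : T| <= #|[set M : {group gT} | maximal M G & ~~ (M <| G)]|.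
  rewrite -(card_orbit_maximal maxT nnT) subset_leq_card //.
  by apply/subsetP=> M /(orbit_maximal maxT)[maxM nsM _]; rewrite inE maxM nsM.
have:= num_maximal_split G; rewrite oG.
set c := #|_|; set nn := #|_| in leNN * => split_num.
set A := [set M : {group gT} | [&& _, _ & _]] in lt_r.
have allA (J : {group gT}) : maximal J G -> J <| G -> #|G : J| = r.
  move=> maxJ nsJ; apply/eqP; apply: contraT => neJ.
  have: #|J |: A| <= c.
    rewrite subset_leq_card //; apply/subsetP=> M.
    by case/setU1P=> [-> | ]; rewrite !inE ?maxJ // => /and3P[-> ->].
  rewrite cardsU1 inE (negbTE neJ) !andbF /=.
  by move: #|A| lt_r => a; clear - leT le_r leNN split_num s_gt0; lia.
have leA: #|A| <= c.
  by rewrite subset_leq_card //; apply/subsetP=> M; rewrite !inE => /and3P[-> ->].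
have eqT: #|G : T| = r.
  by move: #|A| lt_r leA => a; clear - leT le_r leNN split_num s_gt0; lia.
have [V [[nsVG sNV tiVT] abelV minV cVV oV]] := nonnormal_maximal_socle solG maxT nnT.
have nsNG: gcore T G <| G := gcore_normal (maximal_sub maxT).
rewrite eqT in oV.
have cycV: cyclic (V / gcore T G) by rewrite prime_cyclic // oV.
have nVN: G / gcore T G \subset 'N(V / gcore T G).
  by rewrite quotient_norms ?normal_norm.
have dvV: #|G : V| %| r.-1.
  rewrite -(totient_prime r_pr) -oV -card_Aut_cyclic //.
  have sGNV: G :&: gcore T G \subset V by rewrite subIset ?sNV ?orbT.
  rewrite -(index_quotient_eq sGNV (normal_sub nsVG) (normal_norm nsNG)) -cVV.
  exact: card_cent_dvdn_Aut.
have abGV: abelian (G / V).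
  apply: sub_der1_abelian.
  have nNG' := subset_trans (der_sub 1 G) (normal_norm nsNG).
  rewrite -(quotientSGK nNG' sNV) quotient_der ?normal_norm // -cVV subsetI der_sub.
  rewrite -ker_conj_aut -sub_morphim_pre ?(subset_trans (der_sub 1 _)) //=.
  rewrite morphim_der // (derG1P _) // (abelianS (Aut_conj_aut _ _)) //.
  exact: Aut_cyclic_abelian.
have [eqV | [J maxJ sVJ]] := maximal_exists (normal_sub nsVG).
  by case/negP: nnT; have := nsNG; rewrite -tiVT eqV (setIidPr (maximal_sub maxT)).
have nsJ: J <| G.
  rewrite -(quotient_normal_eq nsVG sVJ (maximal_sub maxJ)) -sub_abelian_normal //.
  by rewrite quotientS ?maximal_sub.
have: r %| r.-1.
  by rewrite -{1}(allA J maxJ nsJ) (dvdn_trans _ dvV) // indexgS.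
by have := prime_gt1 r_pr; case: (r) => [|[|m]] // _; rewrite gtnNdvd.
Qed.

(** Replaces [V], which depends on [T], by the derived subgroup, so that with two classes a single
    subgroup covers both socle factors. *)
Lemma socle_der1 gT (G T V : {group gT}) :
    maximal T G -> ~~ (T <| G) -> V <| G -> gcore T G \subset V ->
    V :&: T = gcore T G -> minnormal (V / gcore T G) (G / gcore T G) ->
    #|V / gcore T G| = #|G : T| -> abelian (G / V) ->
  [/\ G^`(1) \subset V, ~~ (G^`(1) \subset T), G^`(1) / gcore T G = V / gcore T G,
      G^`(1) :&: T = G^`(1) :&: gcore T G & #|G^`(1) : G^`(1) :&: gcore T G| = #|G : T|].
Proof.
move=> maxT nnT nsVG sNV tiVT minV oV abGV; have sTG := maximal_sub maxT.
have nsNG: gcore T G <| G := gcore_normal sTG; have nNG := normal_norm nsNG.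
have sG'V: G^`(1) \subset V by apply: der1_min (normal_norm nsVG) abGV.
have sG'G := der_sub 1 G; have nNG' := subset_trans sG'G nNG.
have nsG'T: ~~ (G^`(1) \subset T).
  by apply: contra nnT => sG'T; apply: sub_der1_normal.
have [/andP[ntV nVG] minVb] := mingroupP minV.
have eqG'V: G^`(1) / gcore T G = V / gcore T G.
  apply: (minVb (G^`(1) / gcore T G)%G); last exact: quotientS.
  rewrite quotient_norms ?der_norm // andbT -subG1 quotient_sub1 //.
  by apply: contra nsG'T => sG'N; apply: subset_trans sG'N (gcore_sub _ _).
split=> //; first by rewrite -tiVT setIA (setIidPl sG'V).
by rewrite indexgI -(card_quotient nNG') eqG'V.
Qed.

Lemma prod_primes_of_log1 n :
  0 < n -> {in primes n, forall p, logn p n = 1%N} -> n = (\prod_(p <- primes n) p)%N.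
Proof.
move=> n_gt0 log1; rewrite {1}[n]prod_prime_decomp // prime_decompE big_map /=.
by rewrite !big_seq; apply: eq_bigr => p /log1 ->; rewrite expn1.
Qed.

(** * One class of nonnormal maximal subgroups *)

Section OneClass.

Variables (gT : finGroupType) (G T : {group gT}).
Hypotheses (solG : solvable G) (sepG : normal_maximals_separated G).
Hypotheses (Phi1 : 'Phi(G) = 1) (maxT : maximal T G) (nnT : ~~ (T <| G)).
Hypothesis oneT : forall M : {group gT}, maximal M G -> ~~ (M <| G) ->
  M \in orbit 'JG%act G T.

Lemma one_class_structure :
  exists E T1 Z : {group gT},
    [/\ (E ><| T1) \x Z = G, is_abelem E /\ #|E| = #|G : T|,
        cyclic T1 /\ #|T1| %| #|Aut E|,
        cyclic Z /\ #|Z| = (\prod_(p <- primes #|Z|) p)%N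
      & coprime #|T1| #|Z| /\
        #|[set M : {group gT} | maximal M G & M <| G]|
          = (size (primes #|Z|) + num_maximal T1)%N].
Proof.
have sTG := maximal_sub maxT.
have [V [[nsVG sNV tiVT] abelV minV cVV oV]] := nonnormal_maximal_socle solG maxT nnT.
have nsNG: gcore T G <| G := gcore_normal sTG.
pose N := gcore_group T G; have sNT: N \subset T := gcore_sub _ _.
have nNG: G \subset 'N(N) := gcore_norm T G.
have [/andP[ntV _] _] := mingroupP minV.
have coreM (M : {group gT}) : maximal M G -> ~~ (M <| G) -> N \subset M.
  move=> maxM nnM; have [_ _ [x Gx ->]] := orbit_maximal maxT (oneT maxM nnM).
  by rewrite -(normsP nNG x Gx) conjSg.
have cycGV: cyclic (G / V).
  apply: (separated_quotient_cyclic nsVG sepG) => M maxM sVM; apply: contraT => nnM.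
  have [_ _ [x Gx eqM]] := orbit_maximal maxT (oneT maxM nnM).
  have sVT: V \subset T by rewrite -(conjSg _ _ x) -eqM (normsP (normal_norm nsVG)).
  by case/eqP: ntV; apply: quotientS1; rewrite /= -tiVT subsetI subxx.
have [sG'V nsG'T eqG'V tiG'T iG'N] :=
  socle_der1 maxT nnT nsVG sNV tiVT minV oV (cyclic_abelian cycGV).
pose E := (G^`(1))%G; have nsEG: E <| G := der_normal 1 G.
have sEG := normal_sub nsEG; have nEG := normal_norm nsEG.
have cycGE: cyclic (G / E).
  apply: (separated_quotient_cyclic nsEG sepG) => M maxM sEM.
  exact: sub_der1_normal (maximal_sub maxM).
(* Normal maximal subgroups contain [E] and the others contain [N], so the intersection lies in the
   Frattini subgroup. *)
have tiEN: E :&: N = 1.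
  apply/trivgP; rewrite -Phi1; apply/bigcapsP=> M /predU1P[-> | maxM].
    by rewrite subIset // sEG.
  have [nsM | nnM] := boolP (M <| G).
    by rewrite subIset // der1_sub_maximal_normal.
  by rewrite subIset // coreM ?orbT.
have tiET: E :&: T = 1 by rewrite /E /= tiG'T.
have oE: #|E| = #|G : T| by rewrite -iG'N [_ :&: _]tiEN indexg1.
have nET: T \subset 'N(E) := subset_trans sTG nEG.
have eqG: E * T = G := maximal_normal_mul maxT sEG nEG nsG'T.
have defG: E ><| T = G by rewrite sdprodE.
have cycT: cyclic T by rewrite (isog_cyclic (sdprod_isog defG)).
have nNE: E \subset 'N(N) := subset_trans sEG (normal_norm nsNG).
have abelE: is_abelem E.
  have /is_abelemP[p p_pr pV] := abelV; apply/is_abelemP; exists p => //.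
  by rewrite (isog_abelem (quotient_isog nNE _)) /= ?eqG'V // setIC.
have sNG: N \subset G := normal_sub nsNG.
have cNG: G \subset 'C(N).
  rewrite (sameP commG1P trivgP) -tiEN subsetI commg_subr normal_norm // andbT.
  exact: commgS.
(* Such an element centralises [V / N], the image of [E]; this image is self-centralising, so the
   element lies in [V :&: T = N]. *)
have cTE: 'C_T(E) \subset N.
  apply/subsetP=> x /setIP[Tx cEx]; have Gx := subsetP sTG x Tx.
  have Nx: x \in 'N(N) := subsetP (normal_norm nsNG) x Gx.
  suff Vx: x \in V by rewrite /N /= -tiVT inE Vx.
  have: coset N x \in V / N.
    rewrite /= -cVV inE mem_quotient //= -eqG'V.
    by apply: (subsetP (quotient_cent N E)); rewrite mem_quotient.
  rewrite -!cycle_subG -quotient_cycle // quotientSGK ?cycle_subG //.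
(* An [x] of order [l] in [N] is missed by some maximal [J], necessarily normal since the others
   contain [N]. Then [T] is [<[x]>] times [J :&: T], and as [T] is cyclic, [l] cannot divide the
   second factor. *)
have log1 l : prime l -> l %| #|N| -> logn l #|T| = 1%N.
  move=> l_pr; case/(Cauchy l_pr)=> x Nx ox.
  have [J maxJ nJx]: exists2 J : {group gT}, maximal J G & x \notin J.
    have [/existsP[J /andP[]]|] := boolP [exists J : {group gT}, maximal J G && (x \notin J)].
      by exists J.
    rewrite negb_exists => /forallP noJ.
    have: x \in 'Phi(G).
      apply/bigcapP=> J /predU1P[-> | maxJ]; first exact: subsetP sNG x Nx.
      by have:= noJ J; rewrite maxJ negbK.
    by rewrite Phi1 => /set1P x1; rewrite -ox x1 order1 in l_pr.
  have Tx := subsetP sNT x Nx; have sXT: <[x]> \subset T by rewrite cycle_subG.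
  have nsJ: J <| G by apply: contraR nJx => nnJ; apply: subsetP (coreM J maxJ nnJ) x Nx.
  have tiXJ: <[x]> :&: (J :&: T) = 1.
    by apply: prime_TIg; rewrite -?orderE ?ox // cycle_subG inE (negbTE nJx).
  have eqT: <[x]> * (J :&: T) = T.
    rewrite group_modl // (normC (subset_trans _ (normal_norm nsJ))); last first.
      exact: subset_trans sXT sTG.
    rewrite (mulg_normal_maximal nsJ maxJ) ?(setIidPr sTG) ?cycle_subG //.
    exact: subsetP sTG x Tx.
  rewrite -eqT TI_cardMg // -orderE ox.
  rewrite (lognM _ (prime_gt0 l_pr) (cardG_gt0 _)) logn_prime // eqxx.
  rewrite logn_coprime // prime_coprime //; apply: contra nJx.
  case/(Cauchy l_pr)=> y /setIP[Jy Ty] oy; rewrite -cycle_subG.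
  suff /eqP->: <[x]> == <[y]> :> {set gT} by rewrite cycle_subG.
  by rewrite (eq_subG_cyclic cycT) ?cycle_subG // -!orderE ox oy.
pose pi := \pi(N).
have hallN: pi.-Hall(T) N.
  rewrite /pHall sNT pgroup_pi; apply/pnatP=> // l l_pr dv_l.
  rewrite !inE /= mem_primes l_pr cardG_gt0 /=; apply/negP=> dv_lN.
  have: (l ^ 2 %| #|T|)%N by rewrite -(Lagrange sNT) dvdn_mul.
  by rewrite pfactor_dvdn ?cardG_gt0 // log1.
have nilT: nilpotent T := abelian_nil (cyclic_abelian cycT).
have nsNT: N <| T := normalS sNT sTG nsNG.
pose T1 := 'O_pi^'(T)%G; have sT1T: T1 \subset T := pcore_sub _ _.
have defT: N \x T1 = T.
  by rewrite -(normal_Hall_pcore hallN nsNT) nilpotent_pcoreC.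
have [_ eqT cNT1 tiNT1] := dprodP defT.
have cycT1: cyclic T1 := cyclicS sT1T cycT.
have coT1N: coprime #|T1| #|N|.
  by rewrite coprime_sym (pnat_coprime (pgroup_pi N)) //; apply: pcore_pgroup.
have oT: (#|N| * #|T1|)%N = #|T| := dprod_card defT.
exists E, T1, N; split=> //.
- have nET1: T1 \subset 'N(E) := subset_trans sT1T nET.
  have tiET1: E :&: T1 = 1 by apply/trivgP; rewrite -tiET setIS.
  rewrite sdprodEY // dprodE.
  + by rewrite /= norm_joinEr // -mulgA (normC (cents_norm cNT1)) eqT eqG.
  + rewrite (subset_trans _ (centS _ : 'C(G) \subset _)) ?join_subG ?sEG //.
      by rewrite centsC.
    exact: subset_trans sT1T sTG.
  apply/trivgP/subsetP=> z /setIP[]; rewrite /= norm_joinEr //.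
  case/mulsgP=> e t Ee T1t -> Net.
  have Tt := subsetP sT1T t T1t.
  have e1: e = 1.
    apply/set1P; rewrite -[[set 1]]tiET inE Ee -(groupMr _ Tt).
    exact: subsetP sNT _ Net.
  by rewrite -tiNT1 inE Net e1 mul1g.
- have cT1E: 'C_T1(E) = 1.
    apply/trivgP; rewrite -tiNT1 subsetI subsetIl andbT.
    by apply: subset_trans cTE; apply: setSI.
  by split=> //; rewrite -(indexg1 T1) -cT1E card_cent_dvdn_Aut // (subset_trans sT1T).
- split; first exact: cyclicS cycT.
  apply: prod_primes_of_log1 => // l; rewrite mem_primes => /and3P[l_pr _ dv_l].
  apply/eqP; rewrite eqn_leq -{1}(log1 l l_pr dv_l) dvdn_leq_log ?cardSg //.
  by rewrite -pfactor_dvdn.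
(* Normal maximal subgroups come from the cyclic [G / E], one for each prime divisor of [#|T|];
   these primes split between [N] and [T1]. *)
split=> //; rewrite num_normal_maximals (num_maximal_cyclic cycGE) num_maximal_cyclic //.
rewrite -(card_isog (sdprod_isog defG)) -oT -size_cat.
apply/perm_size/uniq_perm; rewrite ?primes_uniq //.
  by rewrite cat_uniq !primes_uniq andbT -coprime_has_primes // coprime_sym.
by move=> l; rewrite mem_cat primesM.
Qed.
End OneClass.

(** * Two classes of nonnormal maximal subgroups *)

Lemma nilpotent_maximal_normal gT (G M : {group gT}) :
  nilpotent G -> maximal M G -> M <| G.
Proof.
move=> nilG maxM; apply: contraT => nnM.
have := nilpotent_proper_norm nilG (maximal_proper maxM).
by rewrite norm_nonnormal_maximal // properxx.
Qed.

(** If [V] lay in [T2], only the class of [T2] would survive in [G / V], giving a normal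
    [r]-subgroup covering a factor of order [#|G : T2|]. Equal indices force [r = p], and a normal
    [p]-subgroup of the primitive group [G / gcore T1 G] cannot leave its socle. *)
Lemma two_class_socle gT (G T1 T2 V : {group gT}) :
    solvable G -> normal_maximals_separated G ->
    maximal T1 G -> ~~ (T1 <| G) -> maximal T2 G -> ~~ (T2 <| G) ->
    (forall M : {group gT}, maximal M G -> ~~ (M <| G) ->
      (M \in orbit 'JG%act G T1) || (M \in orbit 'JG%act G T2)) ->
    #|G : T1| = #|G : T2| ->
    V <| G -> gcore T1 G \subset V -> V :&: T1 = gcore T1 G ->
    is_abelem (V / gcore T1 G) ->
    minnormal (V / gcore T1 G) (G / gcore T1 G) ->
    'C_(G / gcore T1 G)(V / gcore T1 G) = V / gcore T1 G ->
    #|V / gcore T1 G| = #|G : T1| ->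
  ~~ (V \subset T2).
Proof.
move=> solG sepG max1 nn1 max2 nn2 twoT eq_ix nsVG sNV tiVT abelV minV cVV oV.
apply/negP=> sVT2; have [sT1G sT2G] := (maximal_sub max1, maximal_sub max2).
have nVG := normal_norm nsVG.
have nsNG: gcore T1 G <| G := gcore_normal sT1G; have nNG := normal_norm nsNG.
have [/andP[ntV _] _] := mingroupP minV.
have nsVT1: ~~ (V \subset T1).
  apply: contra ntV => sVT1; apply/eqP/quotientS1.
  by rewrite /= -tiVT subsetI subxx.
have maxT: maximal (T2 / V) (G / V) by apply: max_normal_sub_quotient.
have nnT: ~~ (T2 / V <| G / V) by rewrite quotient_normal_eq.
have oneT (M : {group coset_of V}) : maximal M (G / V) -> ~~ (M <| G / V) ->
    M \in orbit 'JG%act (G / V) (T2 / V)%G.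
  move=> maxM nnM; pose K := (coset V @*^-1 M)%G.
  have maxK: maximal K G by rewrite -(quotientGK nsVG) cosetpre_maximal.
  have nnK: ~~ (K <| G) by rewrite -(quotientGK nsVG) cosetpre_normal.
  have sVK: V \subset K := sub_cosetpre _.
  case/orP: (twoT K maxK nnK) => [/(orbit_maximal max1) | /(orbit_maximal max2)].
    case=> _ _ [x Gx eqK]; case/negP: nsVT1.
    by rewrite -(conjSg _ _ x) -eqK (normsP nVG).
  case=> _ _ [x Gx eqK]; apply/imsetP; exists (coset V x); first exact: mem_quotient.
  apply: val_inj; rewrite /= -quotientJ ?(subsetP nVG) //.
  by rewrite -eqK cosetpreK.
have solGV := quotient_sol V solG.
have [r [R [nsR rR nsRN]]] :=
  single_class_normal_pgroup solGV (separated_quotient nsVG sepG) maxT nnT oneT.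
have oR := card_normal_pgroup_quotient solGV maxT nnT nsR rR nsRN.
have ixT2: #|G / V : T2 / V| = #|G : T1|.
  by rewrite eq_ix index_quotient_eq // subIset // sVT2 orbT.
have /is_abelemP[p p_pr abelVp] := abelV; have pV := abelem_pgroup abelVp.
have [_ dvp _] := pgroup_pdiv pV ntV.
have eq_rp: p = r.
  have: r.-nat p.
    apply: pnat_dvd (pnat_dvd (dvdn_indexg R (gcore (T2 / V) (G / V))) rR).
    by rewrite oR ixT2 -oV.
  by rewrite pnatE // => /eqP.
pose P := (coset V @*^-1 R)%G.
have nsPG: P <| G by rewrite -(quotientGK nsVG) cosetpre_normal.
have sVP: V \subset P := sub_cosetpre _.
have nNP := subset_trans (normal_sub nsPG) nNG.
have pP: p.-group (P / gcore T1 G).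
  rewrite /pgroup card_quotient // -(Lagrange_index sVP sNV) pnatM.
  rewrite -!card_quotient ?(subset_trans (normal_sub nsPG)) //; last first.
    exact: subset_trans sVP nNP.
  by rewrite -/(pgroup p _) /= cosetpreK eq_rp rR -eq_rp.
have sPV: P \subset V.
  rewrite -(quotientSGK nNP sNV).
  apply: (Fitting_minnormal minV (quotientS _ (normal_sub nsVG)) (abelem_abelian abelVp) cVV).
    exact: quotient_normal.
  exact: pgroup_nil pP.
by case/negP: nsRN; rewrite -(cosetpreK R) quotientS1 ?sub1G.
Qed.

Lemma two_class_der1 gT (G T1 T2 : {group gT}) (N1 := gcore T1 G) :
    solvable G -> normal_maximals_separated G ->
    maximal T1 G -> ~~ (T1 <| G) -> maximal T2 G -> ~~ (T2 <| G) ->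
    (forall M : {group gT}, maximal M G -> ~~ (M <| G) ->
      (M \in orbit 'JG%act G T1) || (M \in orbit 'JG%act G T2)) ->
    #|G : T1| = #|G : T2| ->
  [/\ [/\ is_abelem (G^`(1) / N1), minnormal (G^`(1) / N1) (G / N1)
       & #|G^`(1) / N1| = #|G : T1|], ~~ (G^`(1) \subset T1),
      G^`(1) :&: T1 = G^`(1) :&: N1
    & #|G^`(1) : G^`(1) :&: N1| = #|G : T1|].
Proof.
move=> solG sepG max1 nn1 max2 nn2 twoT eq_ix.
have [V [[nsVG sNV tiVT] abelV minV cVV oV]] := nonnormal_maximal_socle solG max1 nn1.
have nsV2 := two_class_socle solG sepG max1 nn1 max2 nn2 twoT eq_ix nsVG sNV tiVT
  abelV minV cVV oV.
have [/andP[ntV _] _] := mingroupP minV; have nVG := normal_norm nsVG.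
have nsV1: ~~ (V \subset T1).
  apply: contra ntV => sVT1; apply/eqP/quotientS1.
  by rewrite /= -tiVT subsetI subxx.
have cycGV: cyclic (G / V).
  apply: (separated_quotient_cyclic nsVG sepG) => M maxM sVM.
  apply: contraT => nnM.
  case/orP: (twoT M maxM nnM) => [/(orbit_maximal max1) | /(orbit_maximal max2)].
    by case=> _ _ [x Gx eqM]; rewrite -(conjSg _ _ x) -eqM (normsP nVG) ?sVM in nsV1.
  by case=> _ _ [x Gx eqM]; rewrite -(conjSg _ _ x) -eqM (normsP nVG) ?sVM in nsV2.
have [sG'V nsG'T eqG'V tiG'T iG'N] :=
  socle_der1 max1 nn1 nsVG sNV tiVT minV oV (cyclic_abelian cycGV).
by split; rewrite // /N1 eqG'V.
Qed.

(* [D :&: N1] meets [N2] trivially, so it embeds in the chief factor [D / N2]. *)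
Lemma card_core_der1 gT (G T1 T2 : {group gT}) (D := (G^`(1))%G)
    (N1 := gcore T1 G) (N2 := gcore T2 G) :
    T1 \subset G -> T2 \subset G -> D :&: N1 :&: N2 = 1 -> D :&: N1 != 1 ->
    is_abelem (D / N2) -> minnormal (D / N2) (G / N2) ->
  is_abelem (D :&: N1) /\ #|D :&: N1| = #|D / N2|.
Proof.
move=> sT1G sT2G tiN ntE abelD minD.
have nsN1: N1 <| G := gcore_normal sT1G; have nsN2: N2 <| G := gcore_normal sT2G.
pose E := (D :&: N1)%G; have sED: E \subset D := subsetIl _ _.
have nsE: E <| G := normalI (der_normal 1 G) nsN1.
have nN2E: E \subset 'N(N2) := subset_trans (normal_sub nsE) (normal_norm nsN2).
have isoE := quotient_isog nN2E (etrans (setIC _ _) tiN).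
have [_ minDb] := mingroupP minD.
have eqED: E / N2 = D / N2.
  apply: (minDb (E / N2)%G); last exact: quotientS.
  rewrite quotient_norms ?normal_norm // andbT -subG1 quotient_sub1 //.
  apply: contra ntE => sEN2; rewrite -subG1 -tiN subsetI subxx.
  exact: sEN2.
split; last by rewrite (card_isog isoE) /= eqED.
have /is_abelemP[p p_pr abelDp] := abelD; apply/is_abelemP; exists p => //.
by rewrite (isog_abelem isoE) /= eqED.
Qed.

Section TwoClasses.

Variables (gT : finGroupType) (G T1 T2 : {group gT}).
Hypotheses (solG : solvable G) (sepG : normal_maximals_separated G).
Hypotheses (Phi1 : 'Phi(G) = 1).
Hypotheses (max1 : maximal T1 G) (nn1 : ~~ (T1 <| G)).
Hypotheses (max2 : maximal T2 G) (nn2 : ~~ (T2 <| G)).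
Hypothesis twoT : forall M : {group gT}, maximal M G -> ~~ (M <| G) ->
  (M \in orbit 'JG%act G T1) || (M \in orbit 'JG%act G T2).
Hypotheses (no12 : T2 \notin orbit 'JG%act G T1) (eq_ix : #|G : T1| = #|G : T2|).
Hypothesis oneN : #|[set M : {group gT} | maximal M G & M <| G]| = 1%N.

Lemma two_class_structure :
  exists E1 E2 P : {group gT}, exists p alpha : nat,
    [/\ (E1 \x E2) ><| P = G,
        is_abelem E1 /\ #|E1| = #|G : T1|, is_abelem E2 /\ #|E2| = #|G : T1|,
        [/\ prime p, 0 < alpha, cyclic P & #|P| = (p ^ alpha)%N]
      & (p ^ alpha)%N %| #|Aut E1|].
Proof.
have [sT1G sT2G] := (maximal_sub max1, maximal_sub max2).
have twoT' (M : {group gT}) : maximal M G -> ~~ (M <| G) ->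
    (M \in orbit 'JG%act G T2) || (M \in orbit 'JG%act G T1).
  by move=> maxM nnM; rewrite orbC twoT.
have [[abelD1 minD1 oD1] nsD1 tiD1 iD1] :=
  two_class_der1 solG sepG max1 nn1 max2 nn2 twoT eq_ix.
have [[abelD2 minD2 oD2] nsD2 tiD2 iD2] :=
  two_class_der1 solG sepG max2 nn2 max1 nn1 twoT' (esym eq_ix).
pose D := (G^`(1))%G; have nsDG: D <| G := der_normal 1 G.
have [sDG nDG] := andP nsDG.
pose N1 := gcore_group T1 G; pose N2 := gcore_group T2 G.
have nsN1: N1 <| G := gcore_normal sT1G; have nsN2: N2 <| G := gcore_normal sT2G.
have coreM (M : {group gT}) : maximal M G -> ~~ (M <| G) ->
    (N1 \subset M) || (N2 \subset M).
  move=> maxM nnM.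
  case/orP: (twoT maxM nnM) => [/(orbit_maximal max1) | /(orbit_maximal max2)].
    case=> _ _ [x Gx ->]; apply/orP; left.
    by rewrite -(normsP (normal_norm nsN1) x Gx) conjSg gcore_sub.
  case=> _ _ [x Gx ->]; apply/orP; right.
  by rewrite -(normsP (normal_norm nsN2) x Gx) conjSg gcore_sub.
have tiN: D :&: N1 :&: N2 = 1.
  apply/trivgP; rewrite -Phi1; apply/bigcapsP=> M /predU1P[-> | maxM].
    by rewrite /= -setIA subIset // sDG.
  have [nsM | nnM] := boolP (M <| G).
    by rewrite /= -setIA subIset // der1_sub_maximal_normal.
  case/orP: (coreM M maxM nnM) => sNM; last by rewrite /= subIset // sNM orbT.
  by rewrite /= setIAC subIset // sNM orbT.
have cycGD: cyclic (G / D).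
  apply: (separated_quotient_cyclic nsDG sepG) => M maxM sDM.
  exact: sub_der1_normal (maximal_sub maxM).
have [s [s_pr sGD dvs]]: exists s : nat, [/\ prime s, s.-nat #|G : D| & s %| #|G : D|].
  have: size (primes #|G / D|) = 1%N.
    by rewrite -(num_maximal_cyclic cycGD) -num_normal_maximals.
  case eq_primes: (primes _) => [|s [|]] // _.
  have mem_s l : (l \in primes #|G / D|) = (l == s) by rewrite eq_primes inE.
  have:= mem_s s; rewrite eqxx mem_primes card_quotient // => /and3P[s_pr _ dvs].
  exists s; split=> //; apply/pnatP=> // l l_pr dvl.
  by have:= mem_s l; rewrite mem_primes l_pr card_quotient ?indexg_gt0 //= dvl => /esym.
have q_gt1: 1 < #|G : T1|.
  by rewrite indexg_gt1; case/andP: (maximal_proper max1).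
pose E1 := (D :&: N1)%G; pose E2 := (D :&: N2)%G.
have [sE1D sE2D]: E1 \subset D /\ E2 \subset D by rewrite !subsetIl.
have nsE1: E1 <| G := normalI nsDG nsN1.
have nsE2: E2 <| G := normalI nsDG nsN2.
have /is_abelemP[p p_pr abelDp] := abelD1.
have pq: p.-nat #|G : T1| by rewrite -oD1; apply: abelem_pgroup abelDp.
have pE1: p.-group E1.
  have nN2E: E1 \subset 'N(N2) by rewrite (subset_trans (normal_sub nsE1)) ?normal_norm.
  rewrite /pgroup (card_isog (quotient_isog nN2E (etrans (setIC _ _) tiN))).
  apply: pnat_dvd pq; rewrite eq_ix -oD2; apply: cardSg.
  exact: quotientS sE1D.
have pD: p.-group D by rewrite /pgroup -(Lagrange sE1D) pnatM [p.-nat _]pE1 /= iD1.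
have ne_sp: s != p.
  apply: contra nn1 => /eqP eq_sp; apply: nilpotent_maximal_normal max1.
  by apply: (pgroup_nil (p := p)); rewrite /pgroup -(Lagrange sDG) pnatM [p.-nat _]pD -eq_sp.
have s'q: s^'.-nat #|G : T1|.
  by apply: sub_in_pnat pq => l _; rewrite !inE => /eqP->; rewrite eq_sym.
(* If [E1] were trivial, [T1] and [T2] would both have order [#|G : D|], hence be Sylow
   [s]-subgroups and conjugate. *)
have ntE1: E1 :!=: 1.
  apply: contra no12 => /eqP E1_1.
  have oD: #|D| = #|G : T1| by rewrite -iD1 [_ :&: _]E1_1 indexg1.
  have oT (T : {group gT}) : T \subset G -> #|G : T| = #|G : T1| -> s.-Sylow(G) T.
    move=> sTG eqT; rewrite /pHall sTG eqT s'q andbT /pgroup.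
    suff ->: #|T| = #|G : D| by [].
    by apply/eqP; rewrite -(eqn_pmul2r (indexg_gt0 G T)) Lagrange // eqT -oD mulnC Lagrange.
  have [x Gx eqT] := Sylow_trans (oT T1 sT1G erefl) (oT T2 sT2G (esym eq_ix)).
  by apply/imsetP; exists x => //; apply: val_inj.
have [abelE1 oE1] := card_core_der1 sT1G sT2G tiN ntE1 abelD2 minD2.
have oE1q: #|E1| = #|G : T1| by rewrite oE1 oD2 eq_ix.
have oD: #|D| = (#|G : T1| * #|G : T1|)%N.
  by rewrite -(Lagrange sE1D) oE1q (iD1 : #|D : E1| = _).
have oE2q: #|E2| = #|G : T1|.
  have iE2: #|D : E2| = #|G : T1| by rewrite eq_ix -iD2.
  by apply/eqP; rewrite -(eqn_pmul2r (ltnW q_gt1)) -oD -{1}iE2 Lagrange.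
have ntE2: E2 :!=: 1 by rewrite -cardG_gt1 oE2q.
have tiN': D :&: N2 :&: N1 = 1 by rewrite setIAC.
have [abelE2 _] := card_core_der1 sT2G sT1G tiN' ntE2 abelD1 minD1.
have tiE: E1 :&: E2 = 1.
  by apply/trivgP; rewrite -tiN setIS // subsetIr.
have cE: E2 \subset 'C(E1).
  rewrite (sameP commG1P trivgP) -tiE setIC commg_subI // subsetI subxx.
    by rewrite (subset_trans (normal_sub nsE2)) ?normal_norm.
  by rewrite (subset_trans (normal_sub nsE1)) ?normal_norm.
have defD: E1 \x E2 = D.
  rewrite dprodE //; apply/eqP; rewrite eqEcard mul_subG //=.
  by rewrite TI_cardMg // oE1q oE2q oD.
have [P sylP] := Sylow_exists s G; have [sPG sP _] := and3P sylP.
have tiDP: D :&: P = 1.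
  apply: coprime_TIg; apply: pnat_coprime pD _.
  by apply: sub_in_pnat sP => l _; rewrite !inE => /eqP->.
have eqG: D * P = G.
  apply/eqP; rewrite eqEcard mul_subG //= TI_cardMg // -(Lagrange sDG) leq_mul2l.
  rewrite (card_Hall sylP) -(Lagrange sDG) partnM // part_p'nat; last first.
    by apply: sub_in_pnat pD => l _; rewrite !inE => /eqP->; rewrite eq_sym.
  by rewrite mul1n part_pnat_id ?leqnn ?orbT.
have defG: D ><| P = G by rewrite sdprodE // (subset_trans sPG).
have isoP := sdprod_isog defG.
have cycP: cyclic P by rewrite (isog_cyclic isoP).
have oP: #|P| = #|G : D| by rewrite (card_isog isoP) card_quotient.
have [alpha oPs] := p_natP sP.
have alpha_gt0: 0 < alpha.
  by rewrite lt0n; apply: contraTneq dvs => a0; rewrite -oP oPs a0 dvdn1 neq_ltn prime_gt1 ?orbT.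
have order_s (X : {group gT}) : X \subset P -> X :!=: 1 -> exists2 x, x \in X & #[x] = s.
  move=> sXP ntX; have [_ dvX _] := pgroup_pdiv (pgroupS sXP sP) ntX.
  by have [x] := Cauchy s_pr dvX; exists x.
have eq_order_s x y : x \in P -> y \in P -> #[x] = s -> #[y] = s -> <[x]> = <[y]>.
  move=> Px Py ox oy; apply/eqP.
  by rewrite (eq_subG_cyclic cycP) ?cycle_subG // -!orderE ox oy.
(* [P] has a single subgroup [<[x]>] of order [s]. If neither action is faithful, it is central in
   [G]; as the Frattini subgroup is trivial, some maximal [M] misses [x], is normal and meets [P]
   trivially. Then [P = <[x]>] and [G] is abelian. *)
have faith: ('C_P(E1) == 1) || ('C_P(E2) == 1).
  apply: contraT; rewrite negb_or => /andP[nt1 nt2].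
  have [x /setIP[Px cE1x] ox] := order_s 'C_P(E1)%G (subsetIl _ _) nt1.
  have [y /setIP[Py cE2y] oy] := order_s 'C_P(E2)%G (subsetIl _ _) nt2.
  have cE2x: x \in 'C(E2) by rewrite -cycle_subG (eq_order_s x y) // cycle_subG.
  have cDx: x \in 'C(D) by rewrite -(dprodWY defD) centY inE cE1x.
  have cPx: x \in 'C(P) by apply: subsetP Px; apply: cyclic_abelian.
  have cGx: x \in 'C(G).
    by rewrite -sub_cent1 -eqG mul_subG // sub_cent1.
  have Gx: x \in G := subsetP sPG x Px.
  have nX (M : {group gT}) : maximal M G -> x \notin M -> <[x]> * M = G.
    move=> maxM nMx; apply: maximal_normal_mul maxM _ _ _; rewrite ?cycle_subG //.
    by rewrite cents_norm // centsC cycle_subG.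
  suff: x \in 'Phi(G) by rewrite Phi1 => /set1P x1; rewrite -ox x1 order1 in s_pr.
  apply/bigcapP=> M /predU1P[-> // | maxM]; apply: contraT => nMx.
  have eqXM := nX M maxM nMx.
  have nsM: M <| G.
    rewrite /normal maximal_sub //= -{1}eqXM mul_subG ?normG // cycle_subG.
    by rewrite (subsetP (cent_sub M)) // (subsetP (centS (maximal_sub maxM))).
  case/negP: nn1; rewrite -sub_abelian_normal //.
  have tiMP: M :&: P = 1.
    apply/eqP; apply: contraR nMx => ntMP.
    have [z /setIP[Mz Pz] oz] := order_s (M :&: P)%G (subsetIr _ _) ntMP.
    by rewrite -cycle_subG (eq_order_s x z) // cycle_subG.
  have eqXP: <[x]> = P.
    have sXP: <[x]> \subset P by rewrite cycle_subG.
    by rewrite -(mulg1 <[x]>) -tiMP group_modl // eqXM (setIidPr sPG).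
  rewrite -eqG abelianM -eqXP cycle_abelian cycle_subG cDx !andbT.
  rewrite -(dprodW defD) abelianM cE andbT.
  by rewrite (abelem_abelian abelE1) (abelem_abelian abelE2).
have dvE (E : {group gT}) : E <| G -> 'C_P(E) = 1 -> s ^ alpha %| #|Aut E|.
  move=> nsE C1; rewrite -oPs -(indexg1 P) -C1 card_cent_dvdn_Aut //.
  by rewrite (subset_trans sPG) ?normal_norm.
(* The conclusion bounds [P] through its first factor only, so the factors are exchanged when
   faithfulness is known on [E2]. *)
case/orP: faith => /eqP C1.
  by exists E1, E2, P, s, alpha; split; rewrite ?defD ?dvE.
by exists E2, E1, P, s, alpha; split; rewrite 1?dprodC ?defD ?dvE.
Qed.
End TwoClasses.

(** * Reduction modulo the Frattini subgroup *)

Lemma num_maximal_Phi gT (G : {group gT}) : num_maximal (G / 'Phi(G)) = num_maximal G.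
Proof.
rewrite num_maximal_quotient ?Phi_normal // /num_maximal; apply: eq_card => M.
by rewrite !inE; apply: andb_idr => /Phi_sub_max.
Qed.

(** Once enlarged to maximal subgroups, the members of a minimal cover contain the Frattini
    subgroup, so the cover descends. *)
Lemma covering_number_Phi gT (G : {group gT}) :
  ~~ cyclic G -> covering_number (G / 'Phi(G)) = covering_number G.
Proof.
move=> ncG; have nsPhi := Phi_normal G.
have ncGPhi: ~~ cyclic (G / 'Phi(G)) by apply: contra ncG; apply: Phi_quotient_cyclic.
apply/eqP; rewrite eqn_leq covering_number_quotient // andbT.
have [C [maxC coverC]] := covering_number_maximal ncG; apply: leq_trans.
apply: leq_trans (leq_imset_card (fun M : {group gT} => (M / 'Phi(G))%G) C).
apply: covering_number_leq => //; apply/andP; split.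
  apply/forall_inP=> _ /imsetP[M /maxC maxM ->].
  by apply/maximal_proper/max_normal_sub_quotient; rewrite ?Phi_sub_max.
rewrite eqEsubset; apply/andP; split.
  by apply/bigcupsP=> _ /imsetP[M /maxC/maximal_sub sMG ->]; apply: quotientS.
apply/subsetP=> _ /morphimP[x Nx Gx ->].
have: x \in \bigcup_(M in C) M by rewrite coverC.
case/bigcupP=> M CM Mx; apply/bigcupP; exists (M / 'Phi(G))%G; first exact: imset_f.
by rewrite mem_quotient.
Qed.

Lemma Phi1_structure gT (G : {group gT}) :
    ~~ nilpotent G -> solvable G -> 'Phi(G) = 1 ->
    num_maximal G = (2 * covering_number G - 1)%N ->
  covering_number G <> 3 /\
  ((exists E T1 Z : {group gT},
      [/\ (E ><| T1) \x Z = G, is_abelem E /\ #|E| = (covering_number G - 1)%N,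
          cyclic T1 /\ #|T1| %| #|Aut E|,
          cyclic Z /\ #|Z| = (\prod_(p <- primes #|Z|) p)%N
        & coprime #|T1| #|Z| /\
          (size (primes #|Z|) + num_maximal T1)%N = covering_number G])
  \/
   (exists E1 E2 P : {group gT}, exists p alpha : nat,
    [/\ (E1 \x E2) ><| P = G,
        is_abelem E1 /\ #|E1| = (covering_number G - 1)%N,
        is_abelem E2 /\ #|E2| = (covering_number G - 1)%N,
        [/\ prime p, 0 < alpha, cyclic P & #|P| = (p ^ alpha)%N]
      & (p ^ alpha)%N %| #|Aut E1|])).
Proof.
move=> nnilG solG Phi1 oG.
have [T0 maxT0 nnT0]: exists2 T : {group gT}, maximal T G & ~~ (T <| G).
  have [/existsP[T /andP[]]|] := boolP [exists T : {group gT}, maximal T G && ~~ (T <| G)].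
    by exists T.
  rewrite negb_exists => /forallP allN; case/negP: nnilG.
  apply: maximals_normal_nilpotent => M maxM.
  by have:= allN M; rewrite maxM negbK.
have ncG := nonnormal_maximal_noncyclic (maximal_sub maxT0) nnT0.
have s_gt0 := covering_number_gt0 ncG.
have sepG := separated_of_num_maximal solG maxT0 nnT0 oG.
have ge_ix (T : {group gT}) : maximal T G -> ~~ (T <| G) -> covering_number G <= #|G : T|.+1.
  by apply: maximal_index_geq => //; rewrite oG; clear - s_gt0; lia.
have [T [maxT nnT oT]]: exists T : {group gT},
    [/\ maximal T G, ~~ (T <| G) & #|G : T| = (covering_number G - 1)%N].
  have [M1 [M2 [max1 max2 neM ns12 [eq_ix lt_ix]]]] := small_maximals solG ncG.
  exists M1; have [ns1 | nn1] := boolP (M1 <| G).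
    by case/eqP: neM; rewrite (sepG M1 M2 max1 max2 ns1 (ns12 ns1) eq_ix).
  split=> //; have := ge_ix M1 max1 nn1.
  by clear - lt_ix; lia.
have T_gt1: 1 < #|G : T|.
  by rewrite indexg_gt1; case/andP: (maximal_proper maxT).
split.
  (* [T] has index [covering_number G - 1], and subgroups of index 2 are normal. *)
  move=> s3; case/negP: nnT; rewrite index2_normal ?maximal_sub //.
  by rewrite oT s3.
pose NN := [set M : {group gT} | maximal M G & ~~ (M <| G)].
have := num_maximal_split G; rewrite -/NN; set c := #|_|; rewrite oG => split_num.
have orbitNN (M : {group gT}) : maximal M G -> ~~ (M <| G) -> orbit 'JG%act G M \subset NN.
  move=> maxM nnM; apply/subsetP=> K /(orbit_maximal maxM)[maxK nsK _].
  by rewrite inE maxK nsK.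
have [allT | ] := boolP (NN \subset orbit 'JG%act G T).
  left; have oneT (M : {group gT}) : maximal M G -> ~~ (M <| G) -> M \in orbit 'JG%act G T.
    by move=> maxM nnM; rewrite (subsetP allT) // inE maxM.
  have oNN: #|NN| = #|G : T|.
    rewrite -(card_orbit_maximal maxT nnT).
    by apply/eqP; rewrite eqn_leq !subset_leq_card // orbitNN.
  have [E [T1 [Z [defG abelE cycT1 cycZ [co oc]]]]] :=
    one_class_structure solG sepG Phi1 maxT nnT oneT.
  exists E, T1, Z; split=> //; first by rewrite -oT.
  split=> //; rewrite -oc -/c; clear - split_num oNN oT s_gt0; lia.
case/subsetPn=> T2; rewrite inE => /andP[max2 nn2] no12; right.
(* One normal maximal subgroup exists by solubility, which leaves at most
   [2 * (covering_number G - 1)] nonnormal ones: two classes use up everything. *)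
have c_gt0: 0 < c.
  have ntG: G :!=: 1 by apply: contra ncG => /eqP->; apply: cyclic1.
  have [H nsH pr_ix] := sol_prime_factor_exists solG ntG.
  apply/card_gt0P; exists H; rewrite inE nsH andbT.
  by apply: p_index_maximal pr_ix; apply: normal_sub.
have le12 := card_two_orbits_leq maxT nnT max2 nn2 no12; rewrite -/NN in le12.
have ge2 := ge_ix T2 max2 nn2.
have eq_ix: #|G : T| = #|G : T2| by clear - split_num c_gt0 le12 ge2 oT; lia.
have c1: c = 1%N by clear - split_num c_gt0 le12 ge2 oT; lia.
have twoT (M : {group gT}) : maximal M G -> ~~ (M <| G) ->
    (M \in orbit 'JG%act G T) || (M \in orbit 'JG%act G T2).
  move=> maxM nnM; apply: contraT; rewrite negb_or => /andP[noM1 noM2].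
  have disj (K L : {group gT}) : L \notin orbit 'JG%act G K ->
      #|orbit 'JG%act G K :&: orbit 'JG%act G L| = 0%N.
    move=> noKL; apply/eqP; rewrite cards_eq0; apply: contraR noKL.
    case/set0Pn=> J /setIP[oK oL]; rewrite -(orbit_eqP oK) orbit_sym //.
  have: #|orbit 'JG%act G M :|: (orbit 'JG%act G T :|: orbit 'JG%act G T2)| <= #|NN|.
    by rewrite subset_leq_card // !subUset !orbitNN.
  rewrite cardsU (cardsU (orbit _ _ T)) (disj _ _ no12) subn0.
  rewrite setIUr cardsU ![orbit _ _ M :&: _]setIC !disj // sub0n subn0.
  rewrite !card_orbit_maximal // => le3.
  by have := ge_ix M maxM nnM; clear - le3 split_num c_gt0 oT T_gt1 eq_ix; lia.
have [E1 [E2 [P [p [a [defG oE1 oE2 oP dvP]]]]]] :=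
  two_class_structure solG sepG Phi1 maxT nnT max2 nn2 twoT no12 eq_ix c1.
by exists E1, E2, P, p, a; rewrite -oT.
Qed.

(** The number of primes is given by a sum to avoid truncated subtraction. The subtractions that
    remain are exact, since a noncyclic group has positive covering number. *)
Theorem theorem2p9 (gT : finGroupType) (G : {group gT}) :
  ~~ nilpotent G -> solvable G ->
  num_maximal G = (2 * covering_number G - 1)%N ->
  covering_number G <> 3 /\
  ((exists (E T Z : {group coset_of 'Phi(G)}) (t : nat) (ps : seq nat),
      [/\ (E ><| T) \x Z = G / 'Phi(G),
          is_abelem E /\ #|E| = (covering_number G - 1)%N,
          [/\ cyclic T, #|T| = t, 0 < t & t %| #|Aut E|],
          cyclic Z /\ #|Z| = (\prod_(p <- ps) p)%N
        & [/\ uniq ps, all prime ps, all (coprime t) ps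
            & (size ps + num_maximal T)%N = covering_number G]])
   \/
   (exists (E1 E2 P : {group coset_of 'Phi(G)}) (p alpha : nat),
      [/\ (E1 \x E2) ><| P = G / 'Phi(G),
          is_abelem E1 /\ #|E1| = (covering_number G - 1)%N,
          is_abelem E2 /\ #|E2| = (covering_number G - 1)%N,
          [/\ prime p, 0 < alpha, cyclic P & #|P| = (p ^ alpha)%N]
        & (p ^ alpha)%N %| #|Aut E1|])).
Proof.
move=> nnilG solG oG.
have ncG: ~~ cyclic G by apply: contra nnilG => /cyclic_abelian/abelian_nil.
have nnilGb: ~~ nilpotent (G / 'Phi(G)).
  apply: contra nnilG => nilGb; apply: maximals_normal_nilpotent => M maxM.
  have sPhiM := Phi_sub_max maxM; have nsPhi := Phi_normal G.
  rewrite -(quotient_normal_eq nsPhi sPhiM (maximal_sub maxM)).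
  exact/nilpotent_maximal_normal/max_normal_sub_quotient.
have := Phi1_structure nnilGb (quotient_sol _ solG) (Phi_quotient_id G).
rewrite /= num_maximal_Phi covering_number_Phi // => /(_ oG)[ne3 cases].
split=> //; case: cases => [[E [T [Z [defG abelE [cycT dvT] abelZ [co sz]]]]]|two].
  left; exists E, T, Z, #|T|, (primes #|Z|); split=> //; split=> //.
  - exact: primes_uniq.
  - by apply/allP=> p; rewrite mem_primes => /andP[].
  apply/allP=> p; rewrite mem_primes => /and3P[_ _ dv].
  exact: coprime_dvdr dv co.
by right.
Qed.
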